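(* Let $(X,\lambda)$ be a weighted polyhedron and let $\mathbb{F}$ be a field whose characteristic is either $0$ or relatively prime to the weights $\lambda(x)$ of all points $x\in X$. Then $H^{AW}_*(X,\lambda;\mathbb{F})$ and $H^{DW}_*(X,\lambda;\mathbb{F})$ are both isomorphic to the ordinary homology $H_*(X;\mathbb{F})$.
   Context: Conventions: simplicial complexes are finite, weighted polyhedra are compact. Weighted complexes. An ascending weight on a simplicial complex $K$ is a function $\mu$ from the simplices of $K$ to the positive integers with $\mu(\sigma')\mid\mu(\sigma)$ whenever $\sigma'$ is a face of $\sigma$; a descending weight satisfies instead $\mu(\sigma)\mid\mu(\sigma')$. A weighted simplicial complex $(K,\mu)$ has a weight of one of these two types. On the oriented simplicial chain groups $C_n(K)$ put $\partial^{\mu}\sigma=\sum_{j=0}^n(-1)^jc_j\,\partial_j\sigma$, where $\partial_j[v_0,\dots,v_n]=[v_0,\dots,\widehat{v}_j,\dots,v_n]$ and $c_j=\mu(\sigma)/\mu(\partial_j\sigma)$ if $\mu$ is ascending, $c_j=\mu(\partial_j\sigma)/\mu(\sigma)$ if $\mu$ is descending. For an abelian group $G$, $H_*(K,\partial^\mu;G)$ is the homology of $(C_*(K)\otimes G,\partial^\mu\otimes\mathrm{id}_G)$. Divisible weights. A weight $\xi$ is divisible if the vertices of every simplex $\sigma$ can be ordered $v_0,\dots,v_k$ with $\xi(v_0)\mid\cdots\mid\xi(v_k)$ and $\xi(\sigma)=\xi(v_k)$ (ascending case) or $\xi(\sigma)=\xi(v_0)$ (descending case). The inversion $\widehat{\xi}$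 of a divisible weight $\xi$ is the divisible weight of the opposite type with the same values on vertices. Weighted polyhedra. For $x\in|K|$ let $\mathrm{Car}_K(x)$ be the unique simplex containing $x$ in its relative interior, and put $\lambda_\mu(x)=\mu(\mathrm{Car}_K(x))$. A weighted polyhedron is a pair $(X,\lambda)$, $X$ a space and $\lambda:X\to\mathbb{Z}_{+}$ a function, for which there is a weight-preserving homeomorphism to $(|K|,\lambda_\mu)$ for some weighted simplicial complex $(K,\mu)$, called a weighted triangulation (a divisibly weighted triangulation if $\mu$ is divisible; these always exist); its type is that of $\mu$. AW/DW-homology. Let $(K,\xi)$ be a divisibly weighted triangulation of $(X,\lambda)$. If $\xi$ is ascending, $H^{AW}_*(X,\lambda;G)=H_*(K,\partial^{\xi};G)$ and $H^{DW}_*(X,\lambda;G)=H_*(K,\partial^{\widehat{\xi}};G)$; if $\xi$ is descending, $H^{AW}_*(X,\lambda;G)=H_*(K,\partial^{\widehat{\xi}};G)$ and $H^{DW}_*(X,\lambda;G)=H_*(K,\partial^{\xi};G)$. Up to isomorphism these do not depend on $(K,\xi)$. *)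

(* Defs.v *)
From HB Require Import structures.
From mathcomp Require Import all_boot all_order all_algebra.
From mathcomp Require Import ring_quotient.
From mathcomp Require Import finmap.
From mathcomp Require Import all_classical all_reals topology normedtype.
(* Only the canonical instances of [monalg] are imported: its notations clash
   with those of [topology]. *)
From mathcomp.multinomials Require Import (canonicals) monalg.

Set Implicit Arguments.
Unset Strict Implicit.
Unset Printing Implicit Defensive.

Import mathcomp.boot.finset GRing.Theory Num.Theory numFieldNormedType.Exports.

Local Open Scope ring_scope.

Section QuotientModule.
Local Open Scope quotient_scope.
Variables (F : fieldType) (V : lmodType F) (I : submodClosed V).

Definition submod_pred : {pred V} := (I : {pred V}).

HB.instance Definition _ := GRing.isZmodClosed.Build V submod_pred
  (GRing.submod_closedB (submodClosedP I)).

Definition quotient_module : Type := @Quotient.quot V submod_pred.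

HB.instance Definition _ := GRing.Zmodule.on quotient_module.
HB.instance Definition _ := EqQuotient.on quotient_module.
HB.instance Definition _ := ZmodQuotient.on quotient_module.

Definition quotient_scale (a : F) (x : quotient_module) : quotient_module :=
  \pi_quotient_module (a *: repr x).

Lemma quotient_scale_pi (a : F) (x : V) :
  quotient_scale a (\pi_quotient_module x) = \pi_quotient_module (a *: x).
Proof.
rewrite /quotient_scale; apply/eqP.
rewrite -Quotient.idealrBE -scalerBr -[_ \in submod_pred]/(_ \in I).
apply: rpredZ.
rewrite -[_ \in I]/(_ \in submod_pred).
by rewrite Quotient.idealrBE reprK.
Qed.

Lemma quotient_piD (x y : V) :
  \pi_quotient_module (x + y) =
  \pi_quotient_module x + \pi_quotient_module y.
Proof. exact: Quotient.pi_add. Qed.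

Lemma quotient_scaleA a b x :
  quotient_scale a (quotient_scale b x) = quotient_scale (a * b) x.
Proof.
elim/quotW: x => x.
by rewrite (quotient_scale_pi b x) !quotient_scale_pi scalerA.
Qed.

Lemma quotient_scale1 : left_id 1 quotient_scale.
Proof.
by elim/quotW=> x; rewrite quotient_scale_pi scale1r.
Qed.

Lemma quotient_scaleDr : right_distributive quotient_scale +%R.
Proof.
move=> a; elim/quotW=> x; elim/quotW=> y.
by rewrite -quotient_piD (quotient_scale_pi a (x + y)) (quotient_scale_pi a x)
  (quotient_scale_pi a y) scalerDr quotient_piD.
Qed.

Lemma quotient_scaleDl x :
  {morph quotient_scale^~ x : a b / a + b}.
Proof.
move=> a b; elim/quotW: x => x.
by rewrite (quotient_scale_pi (a + b) x) (quotient_scale_pi a x)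
  (quotient_scale_pi b x) scalerDl quotient_piD.
Qed.

HB.instance Definition _ := GRing.Zmodule_isLmodule.Build F quotient_module
  quotient_scaleA quotient_scale1 quotient_scaleDr quotient_scaleDl.

End QuotientModule.

Definition lmod_isomorphic (F : fieldType) (U V : lmodType F) : Prop :=
  exists f : {linear U -> V}, bijective f.

(** The free module on a set of generators: finitely supported functions. *)
Notation "{ 'free' F [ B ] }" := (monalg.malg B F)
  (at level 0, F, B at level 2, format "{ 'free'  F [ B ] }") : type_scope.

Section Free.
Variables (F : fieldType) (B : choiceType).

Definition gen (b : B) : {free F[B]} := monalg.mkmalgU b 1.

Definition free_ext (V : lmodType F) (f : B -> V) (c : {free F[B]}) : V :=
  \sum_(b <- monalg.msupp c) monalg.mcoeff b c *: f b.

Lemma free_extEw (V : lmodType F) (f : B -> V) (c : {free F[B]})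
    (D : {fset B}) : (monalg.msupp c `<=` D)%fset ->
  free_ext f c = \sum_(b <- D) monalg.mcoeff b c *: f b.
Proof.
move=> sD; rewrite /free_ext [LHS](big_fset_incl _ sD) // => b _.
by rewrite -monalg.mcoeff_eq0 => /eqP ->; rewrite scale0r.
Qed.

Lemma free_ext_is_linear (V : lmodType F) (f : B -> V) : linear (free_ext f).
Proof.
move=> a x y.
pose D := (monalg.msupp (a *: x + y) `|` (monalg.msupp x `|` monalg.msupp y))%fset.
rewrite !(@free_extEw _ _ _ D); last first.
- exact: fsubsetUl.
- by rewrite /D fsetUCA fsubsetUl.
- by rewrite /D fsetUA fsubsetUr.
rewrite scaler_sumr -big_split /=; apply: eq_bigr => b _.
by rewrite monalg.mcoeffD monalg.mcoeffZ scalerDl scalerA.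
Qed.

HB.instance Definition _ (V : lmodType F) (f : B -> V) :=
  GRing.isLinear.Build F {free F[B]} V _ (free_ext f) (free_ext_is_linear f).

Lemma free_ext_gen (V : lmodType F) (f : B -> V) b : free_ext f (gen b) = f b.
Proof.
rewrite (@free_extEw _ _ _ [fset b]%fset); last exact: monalg.msuppU_le.
by rewrite big_seq_fset1 monalg.mcoeffUU scale1r.
Qed.

End Free.

Record chain_complex (F : fieldType) := ChainComplex {
  chain : nat -> lmodType F;
  differential : forall n, {linear chain n.+1 -> chain n};
  differential_sq : forall n (c : chain n.+2),
    differential n (differential n.+1 c) = 0
}.

Section Homology.
Variables (F : fieldType) (C : chain_complex F).

Definition is_cycle n : {pred chain C n} :=
  match n return {pred chain C n} with
  | 0 => fun=> true
  | m.+1 => fun c => differential C m c == 0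
  end.

Lemma is_cycle_submod n : submod_closed (@is_cycle n).
Proof.
case: n => [|n]; split=> //.
  by rewrite unfold_in /= linear0.
move=> a x y; rewrite !unfold_in /= => /eqP hx /eqP hy.
by rewrite linearP hx hy scaler0 addr0.
Qed.

HB.instance Definition _ n :=
  GRing.isSubmodClosed.Build F (chain C n) (@is_cycle n) (is_cycle_submod n).

Record cycle n := Cycle {
  cycle_val :> chain C n;
  _ : cycle_val \in @is_cycle n
}.

HB.instance Definition _ n := [isSub for @cycle_val n].
HB.instance Definition _ n := [Choice of cycle n by <:].
HB.instance Definition _ n := [SubChoice_isSubLmodule of cycle n by <:].

Definition is_boundary n : {pred cycle n} :=
  fun z => `[< exists c : chain C n.+1, differential C n c = val z >].

Lemma is_boundary_submod n : submod_closed (@is_boundary n).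
Proof.
split=> [|a x y]; rewrite !unfold_in /is_boundary.
  by apply/asboolP; exists 0; rewrite linear0 raddf0.
move=> /asboolP[c hc] /asboolP[d hd]; apply/asboolP; exists (a *: c + d).
by rewrite linearP hc hd -linearP.
Qed.

HB.instance Definition _ n :=
  GRing.isSubmodClosed.Build F (cycle n) (@is_boundary n)
    (is_boundary_submod n).

Definition homology n : lmodType F := quotient_module (@is_boundary n).

End Homology.

(** Cancellation in an alternating double sum over a (semi)simplicial object:
    [g j i] stands for the [i]-th face of the [j]-th face. *)
Lemma alternating_sum0 (F : fieldType) (V : lmodType F) n
    (g : nat -> nat -> V) :
  (forall i j, (i < j)%N -> (j < n.+1)%N -> g j i = g i j.-1) ->
  \sum_(j < n.+1) \sum_(i < n) ((-1) ^+ (j + i) : F) *: g j i = 0.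
Proof.
move=> hg.
pose t j i := ((-1) ^+ (j + i) : F) *: g j i.
have ->: \sum_(j < n.+1) \sum_(i < n) ((-1) ^+ (j + i) : F) *: g j i
  = \sum_(j < n.+1) \sum_(i < n | (i < j)%N) t j i
    + \sum_(j < n.+1) \sum_(i < n | ~~ (i < j)%N) t j i.
  rewrite -big_split /=; apply: eq_bigr => j _.
  by rewrite (bigID (fun i : 'I_n => (i < j)%N)).
rewrite big_ord_recl /= big1 ?add0r; last by move=> i; rewrite ltn0.
rewrite [X in _ + X](exchange_big_dep xpredT) //= -big_split /=.
apply: big1 => k _.
rewrite [X in _ + X]big_mkcond /= big_ord_recr /= -leqNgt.
rewrite (leqNgt n k) ltn_ord /= addr0.
rewrite [X in X + _]big_mkcond -big_split /=; apply: big1 => i _.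
rewrite /bump /= add1n ltnS -leqNgt; case: ifP => ik; last by rewrite addr0.
rewrite /t (hg i k.+1) ?ltnS ?ltn_ord //=.
by rewrite addSn exprS mulN1r scaleNr addnC addNr.
Qed.

Record simplicial_complex (V : finType) := SimplicialComplex {
  simplices :> {set {set V}};
  simplex_neq0 : forall s : {set V}, s \in simplices -> s != set0;
  simplex_face : forall s t : {set V},
    s \in simplices -> t \subset s -> t != set0 ->
    t \in simplices
}.

Inductive weight_type := Ascending | Descending.

Definition opposite (t : weight_type) : weight_type :=
  if t is Ascending then Descending else Ascending.

(** [weight_le t a b]: what a weight of type [t] requires of the weight [a] of a
    face and the weight [b] of a simplex. *)
Definition weight_le (t : weight_type) (a b : nat) : bool :=
  (if t is Ascending then a %| b else b %| a)%N.

Record weighted_complex (V : finType) := WeightedComplex {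
  cplx :> simplicial_complex V;
  wtype : weight_type;
  weight : {set V} -> nat;
  weight_gt0 : forall s : {set V}, s \in cplx -> (0 < weight s)%N;
  weight_face : forall s t : {set V}, s \in cplx -> t \in cplx -> t \subset s ->
    weight_le wtype (weight t) (weight s)
}.

Definition vertex_weight (V : finType) (W : weighted_complex V) (v : V) : nat :=
  weight W [set v].

Definition divisible (V : finType) (W : weighted_complex V) : Prop :=
  forall s : {set V}, s \in W -> exists v p,
    [/\ uniq (v :: p), s = [set x in v :: p],
        path (fun a b => (vertex_weight W a %| vertex_weight W b)%N) v p
      & weight W s =
        vertex_weight W (if wtype W is Ascending then last v p else v)].

Section Inversion.
Variables (V : finType) (W : weighted_complex V).

Definition inversion_weight (s : {set V}) : nat :=
  if wtype W is Ascending then \big[gcdn/0%N]_(v in s) vertex_weight W v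
  else \big[lcmn/1%N]_(v in s) vertex_weight W v.

Lemma vertex_weight_gt0 (s : {set V}) v : s \in W -> v \in s -> (0 < vertex_weight W v)%N.
Proof.
move=> sW vs; apply: weight_gt0; apply: (simplex_face sW).
  by rewrite sub1set.
by apply/set0Pn; exists v; rewrite inE.
Qed.

Lemma inversion_weight_gt0 (s : {set V}) : s \in W -> (0 < inversion_weight s)%N.
Proof.
move=> sW; rewrite /inversion_weight; case: (wtype W).
  have /set0Pn[v vs] := simplex_neq0 sW.
  by rewrite (bigD1 v) //= gcdn_gt0 (vertex_weight_gt0 sW).
apply: (big_ind (fun n => 0 < n)%N) => [//|a b a0 b0|v].
  by rewrite lcmn_gt0 a0.
exact: vertex_weight_gt0.
Qed.

Lemma inversion_weight_face (s t : {set V}) : s \in W -> t \in W -> t \subset s ->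
  weight_le (opposite (wtype W)) (inversion_weight t) (inversion_weight s).
Proof.
move=> _ _ /fintype.subsetP ts; rewrite /inversion_weight; case: (wtype W) => /=.
  by apply/dvdn_biggcdP => v /ts vs; apply: (biggcdn_inf v).
by apply/dvdn_biglcmP => v /ts vs; apply: (biglcmn_sup v).
Qed.

(** For a divisible weight these gcd and lcm over vertices are the least and the
    greatest of the vertex weights; see [inversion_divisible]. *)
Definition inversion : weighted_complex V :=
  WeightedComplex inversion_weight_gt0 inversion_weight_face.

Lemma inversion_vertex v : vertex_weight inversion v = vertex_weight W v.
Proof.
rewrite /vertex_weight /= /inversion_weight.
by case: (wtype W); rewrite big_set1.
Qed.

Lemma inversion_divisible : divisible W -> divisible inversion.
Proof.
move=> divW s sW; have [v [p [up def_s vp ws]]] := divW s sW.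
exists v, p; split=> //.
  rewrite (@eq_path _ _ (fun a b => (vertex_weight W a %| vertex_weight W b)%N)) //.
  by move=> a b; rewrite !inversion_vertex.
have tr : transitive (fun a b => (vertex_weight W a %| vertex_weight W b)%N).
  by move=> b a c; apply: dvdn_trans.
rewrite inversion_vertex /= /inversion_weight.
case: (wtype W) => /=; apply/eqP; rewrite eqn_dvd; apply/andP; split.
- by apply: (biggcdn_inf v) => //; rewrite def_s !inE eqxx.
- apply/dvdn_biggcdP => x; rewrite def_s !inE => /orP[/eqP->//|xp].
  by have /allP/(_ x xp) := order_path_min tr vp.
- apply/dvdn_biglcmP => x; rewrite def_s inE.
  elim: p v x {up def_s ws} vp => [|y p IHp] v x /=.
    by move=> _; rewrite inE => /eqP->.
  move=> /andP[vy yp]; rewrite in_cons => /orP[/eqP->|]; last exact: IHp.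
  by apply: dvdn_trans vy _; apply: IHp; rewrite ?mem_head.
- by apply: (biglcmn_sup (last v p)) => //; rewrite def_s inE mem_last.
Qed.

End Inversion.

Definition del (T : Type) (j : nat) (s : seq T) : seq T :=
  take j s ++ drop j.+1 s.

Lemma del_nil (T : Type) j : del j (@nil T) = [::].
Proof. by case: j. Qed.

Lemma del_cons0 (T : Type) (x : T) s : del 0 (x :: s) = s.
Proof. by rewrite /del take0 drop1. Qed.

Lemma del_consS (T : Type) (x : T) j s : del j.+1 (x :: s) = x :: del j s.
Proof. by []. Qed.

Lemma del_del (T : Type) i j (s : seq T) : (i < j)%N ->
  del i (del j s) = del j.-1 (del i s).
Proof.
elim: s i j => [|x s IHs] i j ij; first by rewrite !del_nil.
case: i j ij => [|i] [|j] // ij; first by rewrite del_consS !del_cons0.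
case: j ij => // j ij.
by rewrite -[j.+2.-1]/(j.+1) !del_consS IHs.
Qed.

Lemma size_del (T : Type) j (s : seq T) : (j < size s)%N ->
  size (del j s) = (size s).-1.
Proof.
move=> js; rewrite size_cat size_takel ?size_drop 1?ltnW //.
by case: (size s) js => // m js; rewrite subSS subnKC.
Qed.

Lemma subseq_del (T : eqType) j (s : seq T) : subseq (del j s) s.
Proof.
by rewrite -{2}(cat_take_drop j s) cat_subseq // -addn1 addnC -drop_drop drop_subseq.
Qed.

Section SimplicialChains.
Variables (V : finType) (K : simplicial_complex V).

Definition nsimplex (n : nat) : Type :=
  {s : {set V} | (s \in K) && (#|s| == n.+1)}.
HB.instance Definition _ n := SubFinite.on (nsimplex n).

(** Oriented chains with coefficients in [F] form the free [F]-module on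
    [nsimplex n], once each simplex is given one of its two orientations.
    Here a simplex [s] is oriented by the enumeration [enum s] of its vertices,
    which is compatible with passing to faces ([enum_face]).  [face j s] omits the
    [j]-th vertex. *)
Definition face_set (j : nat) (s : {set V}) : {set V} :=
  [set v in del j (enum s)].

Lemma enum_face j s : enum (face_set j s) = del j (enum s).
Proof.
have sub : subseq (del j (enum s)) (enum V).
  by apply: subseq_trans (subseq_del _ _) _; rewrite enumT; exact: filter_subseq.
rewrite [RHS](subseq_uniqP (enum_uniq V) sub) enumT.
by apply: eq_filter => v /=; rewrite inE.
Qed.

Lemma face_set_face_set i j s : (i < j)%N ->
  face_set i (face_set j s) = face_set j.-1 (face_set i s).
Proof. by move=> ij; rewrite {1 3}/face_set !enum_face del_del. Qed.

Lemma face_subproof n (j : 'I_n.+2) (s : nsimplex n.+1) :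
  (face_set j (val s) \in K) && (#|face_set j (val s)| == n.+1).
Proof.
case: s => s /= /andP[sK /eqP cs].
have cf : #|face_set j s| = n.+1.
  by rewrite cardE enum_face size_del -cardE cs.
rewrite cf eqxx andbT; apply: (simplex_face sK).
  apply/fintype.subsetP => v; rewrite inE => /(mem_subseq (subseq_del _ _)).
  by rewrite mem_enum.
by rewrite -card_gt0 cf.
Qed.

Definition face n (j : 'I_n.+2) (s : nsimplex n.+1) : nsimplex n :=
  Sub (face_set j (val s)) (face_subproof j s).

Lemma face_face n (i j : nat) (s : nsimplex n.+2) : (i < j)%N -> (j < n.+3)%N ->
  face (inord i) (face (inord j) s) = face (inord j.-1) (face (inord i) s).
Proof.
move=> ij jn; apply: val_inj => /=.
have i2 : (i < n.+2)%N by rewrite -ltnS (leq_ltn_trans ij).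
have j2 : (j.-1 < n.+2)%N by case: j ij jn.
by rewrite (inordK i2) (inordK jn) (inordK j2) (inordK (leqW i2)) face_set_face_set.
Qed.

End SimplicialChains.

Section WeightedChains.
Variables (F : fieldType) (V : finType) (W : weighted_complex V).

Definition face_coef n (j : 'I_n.+2) (s : nsimplex W n.+1) : nat :=
  (if wtype W is Ascending
   then weight W (val s) %/ weight W (val (face j s))
   else weight W (val (face j s)) %/ weight W (val s))%N.

Definition weighted_boundary n (s : nsimplex W n.+1) : {free F[nsimplex W n]} :=
  \sum_(j < n.+2) ((-1) ^+ j * (face_coef j s)%:R) *: gen F (face j s).

Lemma weight_face_face n (i : 'I_n.+2) (j : 'I_n.+3) (s : nsimplex W n.+2) :
  (face_coef j s * face_coef i (face j s) =
   if wtype W is Ascending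
   then weight W (val s) %/ weight W (val (face i (face j s)))
   else weight W (val (face i (face j s))) %/ weight W (val s))%N.
Proof.
have faceK m (k : 'I_m.+2) (u : nsimplex W m.+1) : val (face k u) \subset val u.
  apply/fintype.subsetP => v; rewrite inE => /(mem_subseq (subseq_del _ _)).
  by rewrite mem_enum.
have inK m (u : nsimplex W m) : val u \in W by have /andP[] := valP u.
have h1 := weight_face (inK _ _) (inK _ _) (faceK _ j s).
have h2 := weight_face (inK _ _) (inK _ _) (faceK _ i (face j s)).
have := weight_gt0 (inK _ s); have := weight_gt0 (inK _ (face j s)).
have := weight_gt0 (inK _ (face i (face j s))).
move: h1 h2; rewrite /face_coef /weight_le.
set a := weight W (val s); set b := weight W (val (face j s)).
set c := weight W _.
case: (wtype W) => h1 h2 c0 b0 a0.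
  by rewrite muln_divA // divnK.
by rewrite mulnC muln_divA // divnK.
Qed.


Lemma weighted_boundary_boundary n (c : {free F[nsimplex W n.+2]}) :
  free_ext (@weighted_boundary n) (free_ext (@weighted_boundary n.+1) c) = 0.
Proof.
rewrite {2}/free_ext linear_sum big1 // => s _; rewrite linearZ /=.
suff -> : free_ext (@weighted_boundary n) (weighted_boundary s) = 0.
  by rewrite scaler0.
pose r (t : {set V}) : F := (if wtype W is Ascending
   then weight W (val s) %/ weight W t
   else weight W t %/ weight W (val s))%N%:R.
pose g (j i : nat) := let t := face (inord i : 'I_n.+2) (face (inord j : 'I_n.+3) s) in
  r (val t) *: gen F t.
transitivity (\sum_(j < n.+3) \sum_(i < n.+2) ((-1) ^+ (j + i) : F) *: g j i);
    last first.
  apply: alternating_sum0 => i j ij jn.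
  by rewrite /g face_face.
rewrite linear_sum; apply: eq_bigr => j _.
rewrite linearZ /= free_ext_gen scaler_sumr; apply: eq_bigr => i _.
have -> : g j i = r (val (face i (face j s))) *: gen F (face i (face j s)).
  by rewrite /g (inord_val j) (inord_val i).
rewrite !scalerA mulrACA -exprD -natrM weight_face_face.
by rewrite /r; case: (wtype W).
Qed.

Definition weighted_chain_complex : chain_complex F :=
  @ChainComplex F (fun n => {free F[nsimplex W n]})
    (fun n => free_ext (@weighted_boundary n)) weighted_boundary_boundary.

Definition weighted_homology (n : nat) : lmodType F :=
  homology weighted_chain_complex n.

End WeightedChains.

(** When [W] is a divisibly weighted triangulation of [(X, lambda)], [AW_homology]
    and [DW_homology] are the AW- and DW-homology of [(X, lambda)]. *)
Definition AW_homology (F : fieldType) (V : finType) (W : weighted_complex V) :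
    nat -> lmodType F :=
  weighted_homology F (if wtype W is Ascending then W else inversion W).

Definition DW_homology (F : fieldType) (V : finType) (W : weighted_complex V) :
    nat -> lmodType F :=
  weighted_homology F (if wtype W is Ascending then inversion W else W).

(** Barycentric coordinates on the full simplex with vertex set [V]. *)
Definition full_simplex (R : realType) (V : finType) : set {ptws V -> R} :=
  [set x | (forall v, 0 <= x v) /\ \sum_v x v = 1]%classic.
Arguments full_simplex : clear implicits.

Section SimplexMap.
Variables (R : realType) (V V' : finType) (f : V -> V').
Local Open Scope classical_set_scope.

Definition push (x : {ptws V -> R}) : {ptws V' -> R} :=
  fun v' => \sum_(v | f v == v') x v.

Lemma push_full_simplex x :
  full_simplex R V x -> full_simplex R V' (push x).
Proof.
move=> [x0 x1]; split=> [v'|]; first exact: sumr_ge0.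
by rewrite -x1 /push (partition_big f xpredT).
Qed.

Lemma push_subproof (x : full_simplex R V) : push (val x) \in full_simplex R V'.
Proof. by apply/mem_set/push_full_simplex/set_mem/(valP x). Qed.

(** The affine map which is [f] on vertices. *)
Definition simplex_map (x : full_simplex R V) : full_simplex R V' :=
  exist _ (push (val x)) (push_subproof x).

Lemma simplex_map_continuous : continuous simplex_map.
Proof.
apply: continuous_comp_initial => x.
have FF : Filter ((set_val \o simplex_map) z @[z --> x]).
  exact/fmap_filter/nbhs_filter.
apply/cvg_sup => v'.
apply: (@continuous_comp_initial _ _ _ (fun y : {ptws V' -> R} => y v')
  (set_val \o simplex_map)) => {FF}x.
have cont : continuous
    (fun z : full_simplex R V => \sum_(v | f v == v') (val z : {ptws V -> R}) v).
  apply: (@continuous_big R V +%R 0 _ (@add_continuous R)) => v _ z.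
  exact: (continuous_comp (@initial_continuous _ _ set_val z)
    (@proj_continuous _ _ v _)).
exact: cont.
Qed.

HB.instance Definition _ :=
  @isContinuous.Build _ _ simplex_map simplex_map_continuous.

End SimplexMap.

Lemma simplex_map_comp (R : realType) (V V' V'' : finType) (f : V' -> V'')
    (g : V -> V') (x : full_simplex R V) :
  simplex_map f (simplex_map g x) = simplex_map (f \o g) x.
Proof.
apply: val_inj; apply/funext => v /=.
rewrite /push [RHS](partition_big g (fun v' => f v' == v)) //=.
apply: eq_bigr => v' /eqP fv'; apply: eq_bigl => u.
by case: eqP => [->|_]; rewrite ?andbF // andbT fv' eqxx.
Qed.

Lemma eq_simplex_map (R : realType) (V V' : finType) (f g : V -> V')
    (x : full_simplex R V) :
  f =1 g -> simplex_map f x = simplex_map g x.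
Proof. by move=> /funext ->. Qed.

Section SingularHomology.
Variables (R : realType) (F : fieldType) (X : topologicalType).

Notation singular_simplex n := (continuousType (full_simplex R 'I_n.+1) X).

Definition singular_face n (j : 'I_n.+2) (s : singular_simplex n.+1) :
    singular_simplex n :=
  s \o simplex_map (lift j).

Definition singular_boundary n (s : singular_simplex n.+1) :
    {free F[singular_simplex n]} :=
  \sum_(j < n.+2) ((-1) ^+ j) *: gen F (singular_face j s).

Lemma singular_face_face n (i j : nat) (s : singular_simplex n.+2) :
  (i < j)%N -> (j < n.+3)%N ->
  singular_face (inord i) (singular_face (inord j) s) =
  singular_face (inord j.-1) (singular_face (inord i) s).
Proof.
move=> ij jn; apply/continuousEP => x.
rewrite /singular_face /= !simplex_map_comp; congr (s _).
apply: eq_simplex_map => k; apply: val_inj => /=.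
have i2 : (i < n.+2)%N by rewrite -ltnS (leq_ltn_trans ij).
have j2 : (j.-1 < n.+2)%N by case: j ij jn.
rewrite (inordK i2) (inordK jn) (inordK j2) (inordK (leqW i2)).
case: j ij {jn j2} => // j ij; rewrite [LHS]bumpC.
have -> : bump j.+1 i = i by rewrite /bump ltnNge -ltnS ij.
by rewrite /unbump ij subn1.
Qed.

Lemma singular_boundary_boundary n (c : {free F[singular_simplex n.+2]}) :
  free_ext (@singular_boundary n) (free_ext (@singular_boundary n.+1) c) = 0.
Proof.
rewrite {2}/free_ext linear_sum big1 // => s _; rewrite linearZ /=.
suff -> : free_ext (@singular_boundary n) (singular_boundary s) = 0.
  by rewrite scaler0.
pose g (j i : nat) := gen F (singular_face (inord i : 'I_n.+2)
  (singular_face (inord j : 'I_n.+3) s)).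
transitivity (\sum_(j < n.+3) \sum_(i < n.+2) ((-1) ^+ (j + i) : F) *: g j i);
    last first.
  apply: alternating_sum0 => i j ij jn.
  by rewrite /g singular_face_face.
rewrite linear_sum; apply: eq_bigr => j _.
rewrite linearZ /= free_ext_gen scaler_sumr; apply: eq_bigr => i _.
have -> : g j i = gen F (singular_face i (singular_face j s)).
  by rewrite /g (inord_val j) (inord_val i).
by rewrite scalerA -exprD.
Qed.

Definition singular_chain_complex : chain_complex F :=
  @ChainComplex F (fun n => {free F[singular_simplex n]})
    (fun n => free_ext (@singular_boundary n)) singular_boundary_boundary.

Definition singular_homology (n : nat) : lmodType F :=
  homology singular_chain_complex n.

End SingularHomology.

Section WeightedPolyhedra.
Variable R : realType.

(** A point is in the relative interior of exactly one simplex, spanned by the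
    vertices at which its barycentric coordinates do not vanish. *)
Definition carrier (V : finType) (x : {ptws V -> R}) : {set V} :=
  [set v | x v != 0].

Definition realization (V : finType) (K : simplicial_complex V) :
    set {ptws V -> R} :=
  [set x | full_simplex R V x /\ carrier x \in K]%classic.

Definition homeomorphism (X Y : topologicalType) (h : X -> Y) : Prop :=
  continuous h /\
  exists g : Y -> X, [/\ continuous g, cancel h g & cancel g h].

Definition weighted_triangulation (V : finType) (W : weighted_complex V)
    (X : topologicalType) (lambda : X -> nat) : Prop :=
  exists h : X -> realization W,
    homeomorphism h /\ forall x, lambda x = weight W (carrier (val (h x))).

Definition weighted_polyhedron (X : topologicalType) (lambda : X -> nat) :
    Prop :=
  exists (V : finType) (W : weighted_complex V), weighted_triangulation W lambda.

End WeightedPolyhedra.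

(* Main.v *)
Require Import Defs.
From HB Require Import structures.
From mathcomp Require Import all_boot all_order all_algebra.
From mathcomp Require Import finmap.
From mathcomp Require Import all_classical all_reals topology normedtype sequences.
From mathcomp Require Import lra.
From mathcomp.multinomials Require Import (canonicals) monalg.

Set Implicit Arguments.
Unset Strict Implicit.
Unset Printing Implicit Defensive.

Import mathcomp.boot.finset Order.TTheory GRing.Theory Num.Theory numFieldNormedType.Exports.
Import Defs.

Local Open Scope ring_scope.

(** Over [F] every weight occurring is invertible, so multiplying each simplex
    by its weight (or by its inverse, in the descending case) turns the weighted
    boundary into the ordinary one. The vertex weights are invertible too, hence
    so are their gcds and lcms, which are the weights of the inversion.

    It remains to compare simplicial and singular homology of a polyhedron. Let
    [theta] realize simplices of [K] as affine singular simplices. Label a point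
    by a vertex with largest barycentric coordinate. By compactness, an iterated
    barycentric subdivision [Sd] of a singular chain is small: the label of each
    vertex of a singular simplex is a vertex of the carrier of all its points.
    The labels of a small simplex thus span a simplex of [K], which gives a chain
    map [L] from small chains to ordered simplicial chains, and straight lines
    yield a homotopy from [theta L] to the identity. Conversely [L Sd theta] and
    the identity are both carried by the faces of a simplex, so they are
    homotopic, as are the orientation of ordered simplices and the identity.

    All these operators on simplices come from one recursion, [op s = f s +
    a cone_p (op (bd s))], which makes homotopies and naturality automatic. *)

(** * Free modules and homology *)

(** Two obstacles shape the proof. The number of subdivisions that makes a chain small depends on
    the chain, so labelling after subdivision is not a single chain map and no global inverse of
    [theta] is at hand. Injectivity and surjectivity on homology are therefore checked one cycle at
    a time, where the boundary terms of the homotopies vanish. Moreover, building operators directly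
    on singular simplices would require a continuity proof for each intermediate map. Instead,
    operators act on lists of points of a vector space, are evaluated on the vertices of the
    standard simplex, and only the result is composed with the singular simplex. Lists of all
    lengths form one module; degrees and subcomplexes are expressed by predicates on supports. The
    list complex is augmented by the empty list, while the singular and weighted complexes are not;
    the mismatch shows only in degree 0 and is absorbed by homotopies that kill the empty list. *)

Section FreeModule.
Variables (F : fieldType) (B : choiceType).
Implicit Types (A : B -> Prop) (c : {free F[B]}).

Definition supported A c : Prop := forall b, b \in monalg.msupp c -> A b.

Lemma supported_gen A b : A b -> supported A (gen F b).
Proof. by move=> Ab b' /(fsubsetP monalg.msuppU_le); rewrite in_fset1 => /eqP ->. Qed.

Lemma supported0 A : supported A 0.
Proof. by move=> b; rewrite monalg.msupp0 in_fset0. Qed.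

Lemma supportedD A c d : supported A c -> supported A d -> supported A (c + d).
Proof.
move=> Ac Ad b /(fsubsetP (monalg.msuppD_le c d)).
by rewrite in_fsetU => /orP[/Ac|/Ad].
Qed.

Lemma supportedZ A a c : supported A c -> supported A (a *: c).
Proof. by move=> Ac b /(fsubsetP (monalg.msuppZ_le a c)) /Ac. Qed.

Lemma supportedN A c : supported A c -> supported A (- c).
Proof. by rewrite -scaleN1r; apply: supportedZ. Qed.

Lemma supportedB A c d : supported A c -> supported A d -> supported A (c - d).
Proof. by move=> Ac /supportedN; apply: supportedD. Qed.

Lemma supported_sum A (I : Type) (r : seq I) (P : pred I) (f : I -> {free F[B]}) :
  (forall i, P i -> supported A (f i)) ->
  supported A (\sum_(i <- r | P i) f i).
Proof.
by move=> Af; apply: big_ind => //; [exact: supported0 | exact: supportedD].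
Qed.

Lemma sub_supported A A' c :
  (forall b, A b -> A' b) -> supported A c -> supported A' c.
Proof. by move=> AA' Ac b /Ac /AA'. Qed.

Lemma supported_false A c : (forall b, ~ A b) -> supported A c -> c = 0.
Proof.
move=> nA Ac; apply/monalg.malgP => b; rewrite monalg.mcoeff0.
by apply: monalg.mcoeff_outdom; apply/negP => /Ac /nA.
Qed.

Lemma free_ext_id c : free_ext (@gen F B) c = c.
Proof.
rewrite /free_ext [RHS]monalg.monalgE; apply: eq_bigr => b _.
by apply/monalg.malgP => k; rewrite monalg.mcoeffZ !monalg.mcoeffU mulrnAr mulr1.
Qed.

Lemma eq_free_ext_in (V : lmodType F) (f g : B -> V) c :
  supported (fun b => f b = g b) c -> free_ext f c = free_ext g c.
Proof. by move=> fg; apply: eq_big_seq => b /fg ->. Qed.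

Lemma linear_free_ext (V V' : lmodType F) (phi : {linear V -> V'}) (f : B -> V) c :
  phi (free_ext f c) = free_ext (phi \o f) c.
Proof. by rewrite linear_sum; apply: eq_bigr => b _; rewrite linearZ. Qed.

Lemma linear_eq_supported (V : lmodType F) (phi psi : {linear {free F[B]} -> V})
    A c :
  (forall b, A b -> phi (gen F b) = psi (gen F b)) -> supported A c ->
  phi c = psi c.
Proof.
move=> eq_A Ac; rewrite -[c]free_ext_id !linear_free_ext.
by apply: eq_free_ext_in => b /Ac /eq_A.
Qed.

Lemma linear_eq_gen (V : lmodType F) (phi psi : {linear {free F[B]} -> V}) :
  (forall b, phi (gen F b) = psi (gen F b)) -> phi =1 psi.
Proof. by move=> eqg c; apply: (linear_eq_supported (A := fun=> True)). Qed.

End FreeModule.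

Lemma supported_ext (F : fieldType) (B B' : choiceType) (A : B -> Prop)
    (A' : B' -> Prop) (f : B -> {free F[B']}) c :
  (forall b, A b -> supported A' (f b)) -> supported A c ->
  supported A' (free_ext f c).
Proof.
move=> Af Ac; rewrite /free_ext big_seq_cond; apply: supported_sum => b.
by rewrite andbT => /Ac /Af; apply: supportedZ.
Qed.

(** [free_ext] protected from unfolding: conversion would otherwise expand it
    to a sum over the support. *)
Section LinExt.
Variables (F : fieldType) (B : choiceType) (V : lmodType F) (f : B -> V).

Definition lin_ext : {free F[B]} -> V := locked (free_ext f).

Lemma lin_extE c : lin_ext c = free_ext f c.
Proof. by rewrite /lin_ext -lock. Qed.

Lemma lin_ext_is_linear : linear lin_ext.
Proof. by move=> a x y; rewrite !lin_extE linearP. Qed.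

HB.instance Definition _ := GRing.isLinear.Build F {free F[B]} V _ lin_ext
  lin_ext_is_linear.

Lemma lin_ext_gen b : lin_ext (gen F b) = f b.
Proof. by rewrite lin_extE free_ext_gen. Qed.

End LinExt.

Lemma eq_lin_ext_in (F : fieldType) (B : choiceType) (V : lmodType F)
    (f g : B -> V) c :
  supported (fun b => f b = g b) c -> lin_ext f c = lin_ext g c.
Proof. by rewrite !lin_extE; apply: eq_free_ext_in. Qed.

Lemma supported_lin_ext (F : fieldType) (B B' : choiceType) (A : B -> Prop)
    (A' : B' -> Prop) (f : B -> {free F[B']}) c :
  (forall b, A b -> supported A' (f b)) -> supported A c ->
  supported A' (lin_ext f c).
Proof. by rewrite lin_extE; apply: supported_ext. Qed.

Local Open Scope quotient_scope.

Lemma homology_pi_eq (F : fieldType) (C : chain_complex F) n (x y : cycle C n) :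
  (\pi_(homology C n) x = \pi_(homology C n) y) <->
  exists w, differential C n w = val x - val y.
Proof.
split.
  move/eqP; rewrite -Quotient.idealrBE /is_boundary => /asboolP[w ew].
  by exists w; rewrite ew raddfB.
move=> [w ew]; apply/eqP; rewrite -Quotient.idealrBE; apply/asboolP.
by exists w; rewrite ew raddfB.
Qed.

Section HomologyIso.
Variables (F : fieldType) (C D : chain_complex F).

Variable f : forall n, {linear chain C n -> chain D n}.
Hypothesis fd : forall n c, differential D n (f n.+1 c) = f n (differential C n c).

Lemma chain_map_cycle n (z : chain C n) : is_cycle z -> is_cycle (f n z).
Proof. by case: n z => [//|n] z /eqP zC; rewrite /is_cycle fd zC linear0. Qed.

(** Bijectivity is reduced to conditions on single cycles, because the witnesses found later depend
    on the cycle and do not assemble into an inverse chain map. *)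
Lemma homology_iso n :
  (forall z, is_cycle z -> (exists w, differential D n w = f n z) ->
     exists w, differential C n w = z) ->
  (forall z, is_cycle z -> exists2 z' : chain C n, is_cycle z' &
     exists w, differential D n w = z - f n z') ->
  lmod_isomorphic (homology C n) (homology D n).
Proof.
move=> inj surj.
pose fz (z : cycle C n) : cycle D n := Cycle (chain_map_cycle (valP z)).
(* Defined through a chosen representative; [gpi] shows that the choice is immaterial, since [f]
   sends boundaries to boundaries. *)
pose g (x : homology C n) : homology D n := \pi_(homology D n) (fz (repr x)).
have gpi z : g (\pi_(homology C n) z) = \pi_(homology D n) (fz z).
  apply/homology_pi_eq => /=.
  have /homology_pi_eq[w ew] :
      \pi_(homology C n) (repr (\pi_(homology C n) z)) = \pi_(homology C n) z.
    by rewrite reprK.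
  by exists (f n.+1 w); rewrite fd ew linearB.
have lin_g : linear g.
  move=> a x y; elim/quotW: x => x; elim/quotW: y => y.
  have -> : a *: \pi_(homology C n) x + \pi_(homology C n) y =
      \pi_(homology C n) (a *: x + y).
    by rewrite quotient_piD; congr (_ + _); exact: quotient_scale_pi.
  rewrite !gpi.
  have -> : fz (a *: x + y) = a *: fz x + fz y.
    by apply: val_inj; rewrite /= linearP.
  rewrite quotient_piD; congr (_ + _); symmetry; exact: quotient_scale_pi.
pose gl := GRing.isLinear.Build F _ _ _ g lin_g.
pose G : {linear homology C n -> homology D n} := HB.pack g gl.
exists G.
have g_inj : injective g.
  move=> x y; elim/quotW: x => x; elim/quotW: y => y; rewrite !gpi.
  move=> /homology_pi_eq[w /= ew]; apply/homology_pi_eq.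
  rewrite -raddfB; apply: inj; first exact: valP.
  by exists w; rewrite ew linearB.
have /choice[g' g'K] : forall y, exists x, g x = y.
  elim/quotW => y; have [z' z'C [w ew]] := surj (val y) (valP y).
  exists (\pi_(homology C n) (Cycle z'C)); rewrite gpi; apply/homology_pi_eq.
  by exists (- w); rewrite linearN ew opprB.
by exists g' => [x|//]; apply: g_inj.
Qed.

End HomologyIso.

Local Close Scope quotient_scope.

Lemma lmod_isomorphic_trans (F : fieldType) (U V W : lmodType F) :
  lmod_isomorphic U V -> lmod_isomorphic V W -> lmod_isomorphic U W.
Proof. by move=> [f fb] [g gb]; exists (g \o f); apply: bij_comp. Qed.

(** * Chains of lists *)

Section ListChains.
Variables (F : fieldType) (P : choiceType).
Implicit Types (p : P) (s : seq P) (c : {free F[seq P]}).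

Definition cone p : {free F[seq P]} -> {free F[seq P]} :=
  lin_ext (fun s => gen F (p :: s)).
HB.instance Definition _ p := GRing.Linear.on (cone p).

Lemma cone_gen p s : cone p (gen F s) = gen F (p :: s).
Proof. exact: lin_ext_gen. Qed.

Lemma supported_cone (A A' : seq P -> Prop) p c :
  (forall s, A s -> A' (p :: s)) -> supported A c -> supported A' (cone p c).
Proof.
by move=> AA'; apply: supported_lin_ext => s /AA' As; apply: supported_gen.
Qed.

(** A list is an ordered simplex, degenerate ones included; the empty list,
    which spans degree -1, makes the complex augmented, so that [cone p] is a
    contraction in every degree. *)
Fixpoint list_boundary s : {free F[seq P]} :=
  if s is p :: s' then gen F s' - cone p (list_boundary s') else 0.

Definition bd : {free F[seq P]} -> {free F[seq P]} :=
  lin_ext list_boundary.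
HB.instance Definition _ := GRing.Linear.on bd.

Lemma bd_gen s : bd (gen F s) = list_boundary s.
Proof. exact: lin_ext_gen. Qed.

Lemma bd_cone p c : bd (cone p c) = c - cone p (bd c).
Proof.
pose psi : {linear {free F[seq P]} -> {free F[seq P]}} := idfun \- (cone p \o bd).
rewrite -[RHS]/(psi c) -[LHS]/((bd \o cone p) c).
by apply: linear_eq_gen => s; rewrite /= cone_gen !bd_gen.
Qed.

Lemma bd_bd c : bd (bd c) = 0.
Proof.
pose psi : {linear {free F[seq P]} -> {free F[seq P]}} := \0.
rewrite -[RHS]/(psi c) -[LHS]/((bd \o bd) c).
apply: linear_eq_gen => s; rewrite /= bd_gen.
elim: s => [|p s IHs] /=; first by rewrite linear0.
by rewrite linearB /= bd_gen bd_cone /= IHs linear0 subr0 subrr.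
Qed.

(** The recursive form suits induction with cones; this closed form is the one to compare with the
    singular and the weighted boundary. *)
Lemma list_boundaryE s :
  list_boundary s = \sum_(j < size s) (-1) ^+ j *: gen F (del j s).
Proof.
elim: s => [|p s IHs]; first by rewrite big_ord0.
rewrite big_ord_recl /= expr0 scale1r del_cons0 IHs (linear_sum (cone p)) -sumrN.
congr (_ + _); apply: eq_bigr => j _.
rewrite /bump /= add1n del_consS exprS mulN1r scaleNr -cone_gen.
by rewrite linearZ.
Qed.

Lemma supported_list_boundary (A : seq P -> Prop) s :
  (forall j, (j < size s)%N -> A (del j s)) -> supported A (list_boundary s).
Proof.
move=> As; rewrite list_boundaryE; apply: supported_sum => j _.
by apply: supportedZ; apply: supported_gen; apply: As.
Qed.

End ListChains.

Arguments cone {F P}.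
Arguments list_boundary {F P}.
Arguments bd {F P}.

Section ListMap.
Variables (F : fieldType) (P Q : choiceType).
Implicit Types (phi : P -> Q) (c : {free F[seq P]}).

Definition lmap phi : {free F[seq P]} -> {free F[seq Q]} :=
  lin_ext (fun s => gen F (map phi s)).
HB.instance Definition _ phi := GRing.Linear.on (lmap phi).

Lemma lmap_gen phi s : lmap phi (gen F s) = gen F (map phi s).
Proof. exact: lin_ext_gen. Qed.

Lemma lmap_cone phi p c : lmap phi (cone p c) = cone (phi p) (lmap phi c).
Proof.
rewrite -[LHS]/((lmap phi \o cone p) c) -[RHS]/((cone (phi p) \o lmap phi) c).
by apply: linear_eq_gen => s; rewrite /= !(lmap_gen, cone_gen).
Qed.

Lemma bd_lmap phi c : bd (lmap phi c) = lmap phi (bd c).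
Proof.
rewrite -[LHS]/((bd \o lmap phi) c) -[RHS]/((lmap phi \o bd) c).
apply: linear_eq_gen => s; rewrite /= lmap_gen !bd_gen.
by elim: s => [|p s IHs] /=; rewrite ?linear0 // IHs linearB /= lmap_gen lmap_cone.
Qed.

Lemma supported_lmap (A : seq P -> Prop) (A' : seq Q -> Prop) phi c :
  (forall s, A s -> A' (map phi s)) -> supported A c -> supported A' (lmap phi c).
Proof.
by move=> AA'; apply: supported_lin_ext => s /AA' As; apply: supported_gen.
Qed.

End ListMap.

Lemma lmap_comp (F : fieldType) (P Q S : choiceType) (phi : Q -> S) (psi : P -> Q)
    (c : {free F[seq P]}) :
  lmap phi (lmap psi c) = lmap (phi \o psi) c.
Proof.
rewrite -[LHS]/((lmap phi \o lmap psi) c).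
by apply: linear_eq_gen => s; rewrite /= !lmap_gen map_comp.
Qed.

(** * Operators defined by coning over the boundary *)

Section ConeRecursion.
Variable F : fieldType.

Section ConeRec.
Variables (P Q : choiceType) (f : seq P -> {free F[seq Q]}) (apex : seq P -> Q).
Variable a : F.

(** Faces of [s] are not subterms of [s], hence the fuel. Each face is one shorter, so [size s] is
    enough, and stopping with 0 is right for the empty list, whose boundary is 0. *)
Fixpoint cone_rec_fuel n (s : seq P) : {free F[seq Q]} :=
  f s + (if n is n'.+1 then
           a *: cone (apex s) (lin_ext (cone_rec_fuel n') (list_boundary s))
         else 0).

Definition cone_rec_list s := cone_rec_fuel (size s) s.

Definition cone_rec : {free F[seq P]} -> {free F[seq Q]} :=
  lin_ext cone_rec_list.
HB.instance Definition _ := GRing.Linear.on cone_rec.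

Lemma cone_rec_gen s :
  cone_rec (gen F s) = f s + a *: cone (apex s) (cone_rec (list_boundary s)).
Proof.
rewrite {1}/cone_rec lin_ext_gen /cone_rec_list.
case sz : (size s) => [|n] /=.
  by move/size0nil: sz => ->; rewrite /= !linear0.
congr (_ + _ *: cone _ _); apply: eq_lin_ext_in.
by apply: supported_list_boundary => j js; rewrite /cone_rec_list size_del // sz.
Qed.

(** The carrier argument: a relation between a list and the terms of its image passes from the faces
    to the list as soon as it survives adding the apex. *)
Lemma supported_cone_rec (A : seq P -> seq Q -> Prop) :
  (forall s j t, (j < size s)%N -> A (del j s) t -> A s (apex s :: t)) ->
  (forall s, supported (A s) (f s)) ->
  forall s, supported (A s) (cone_rec (gen F s)).
Proof.
move=> Aap Af s; have [n] := ubnP (size s); elim: n s => // n IHn s sn.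
rewrite cone_rec_gen; apply: supportedD => //; apply: supportedZ.
apply: (@supported_cone _ _
  (fun t => exists2 j, (j < size s)%N & A (del j s) t)).
  by move=> t [j js]; apply: Aap js.
apply: (@supported_lin_ext _ _ _ (fun t => exists2 j, (j < size s)%N & t = del j s)).
  move=> _ [j js ->]; apply: (@sub_supported _ _ (A (del j s))).
    by move=> t; exists j.
  have := IHn (del j s); rewrite /cone_rec lin_ext_gen; apply.
  by rewrite size_del //; case: (size s) js sn.
by apply: supported_list_boundary => j; exists j.
Qed.

End ConeRec.

(** The apex of the empty list is unconstrained because it only cones over the zero chain. *)
Lemma cone_rec_natural (P P' Q Q' : choiceType) (phi : P -> P') (psi : Q -> Q')
    (f : seq P -> {free F[seq Q]}) (f' : seq P' -> {free F[seq Q']})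
    (apex : seq P -> Q) (apex' : seq P' -> Q') (a : F) :
  (forall s, f' (map phi s) = lmap psi (f s)) ->
  (forall s, s != [::] -> apex' (map phi s) = psi (apex s)) ->
  forall c, cone_rec f' apex' a (lmap phi c) = lmap psi (cone_rec f apex a c).
Proof.
move=> ff' aa' c.
rewrite -[LHS]/((cone_rec f' apex' a \o lmap phi) c).
rewrite -[RHS]/((lmap psi \o cone_rec f apex a) c).
apply: linear_eq_gen => s /=; rewrite lmap_gen.
have [n] := ubnP (size s); elim: n s => // n IHn s sn.
have bd_s : cone_rec f' apex' a (list_boundary (map phi s)) =
    lmap psi (cone_rec f apex a (list_boundary s)).
  rewrite -bd_gen -lmap_gen bd_lmap bd_gen.
  rewrite -[LHS]/((cone_rec f' apex' a \o lmap phi) (list_boundary s)).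
  rewrite -[RHS]/((lmap psi \o cone_rec f apex a) (list_boundary s)).
  apply: (linear_eq_supported (A := fun t => (size t < n)%N)) => /=.
    by move=> t tn; rewrite lmap_gen IHn.
  apply: supported_list_boundary => j js.
  by rewrite size_del //; case: (size s) js sn.
rewrite !cone_rec_gen linearD bd_s /= ff'; congr (_ + _).
rewrite linearZ /= lmap_cone; congr (_ *: _).
by case: s {sn bd_s} => [|p s]; [rewrite /= !linear0 | rewrite aa'].
Qed.

Section ConeMap.
Variables (P Q : choiceType) (apex : seq P -> Q).

(** The augmented chain map determined by its apexes; barycenters as apexes give barycentric
    subdivision. *)
Definition cone_map : {free F[seq P]} -> {free F[seq Q]} :=
  cone_rec (fun s => if s is [::] then gen F [::] else 0) apex 1.
HB.instance Definition _ := GRing.Linear.on cone_map.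

Lemma cone_map_gen s :
  cone_map (gen F s) = if s is [::] then gen F [::]
    else cone (apex s) (cone_map (list_boundary s)).
Proof.
rewrite {1}/cone_map cone_rec_gen scale1r.
by case: s => [|p s] /=; rewrite ?add0r // !linear0 addr0.
Qed.

(** By induction the map commutes with [bd] on the faces of [s], so the image of the boundary of [s]
    is a cycle; the boundary of a cone over a cycle is that cycle. *)
Lemma bd_cone_map c :
  bd (cone_map c) = cone_map (bd c).
Proof.
rewrite -[LHS]/((bd \o cone_map) c) -[RHS]/((cone_map \o bd) c).
apply: linear_eq_gen => s /=.
have [n] := ubnP (size s); elim: n s => // n IHn s sn.
rewrite cone_map_gen; case: s sn => [_|p s sn].
  by rewrite !bd_gen /= linear0.
rewrite bd_cone.
suff -> : bd (cone_map (list_boundary (p :: s))) =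
    cone_map (bd (list_boundary (p :: s))).
  by rewrite -bd_gen bd_bd !linear0 addr0.
rewrite -[LHS]/((bd \o cone_map) (list_boundary (p :: s))).
rewrite -[RHS]/((cone_map \o bd) (list_boundary (p :: s))).
apply: (linear_eq_supported (A := fun t => (size t < n)%N)).
  by move=> t /= /IHn.
by apply: supported_list_boundary => j js; rewrite size_del.
Qed.

End ConeMap.

Section Homotopy.
Variables (P Q : choiceType) (g : {linear {free F[seq P]} -> {free F[seq Q]}}).
Variable apex : seq P -> Q.

(** Solves [bd H = g - H bd] for a chain map [g], in practice a difference of two augmented maps, by
    coning off the right-hand side; see [cone_homotopy_gen]. *)
Definition cone_homotopy : {free F[seq P]} -> {free F[seq Q]} :=
  cone_rec (fun s => cone (apex s) (g (gen F s))) apex (-1).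
HB.instance Definition _ := GRing.Linear.on cone_homotopy.

Lemma cone_homotopy_gen s : cone_homotopy (gen F s) =
  cone (apex s) (g (gen F s) - cone_homotopy (list_boundary s)).
Proof. by rewrite {1}/cone_homotopy cone_rec_gen scaleN1r linearB. Qed.

Hypothesis bd_g : forall c, bd (g c) = g (bd c).
Hypothesis g_nil : g (gen F [::]) = 0.

Lemma cone_homotopy_nil : cone_homotopy (gen F [::]) = 0.
Proof. by rewrite cone_homotopy_gen g_nil /= linear0 subr0 linear0. Qed.

(** By induction, [bd (g s - H (bd s)) = g (bd s) - (g (bd s) - H (bd (bd s))) = 0], and the cone
    over this cycle has it as boundary. *)
Lemma bd_cone_homotopy c :
  bd (cone_homotopy c) = g c - cone_homotopy (bd c).
Proof.
pose psi : {linear {free F[seq P]} -> {free F[seq Q]}} :=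
  g \- (cone_homotopy \o bd).
rewrite -[LHS]/((bd \o cone_homotopy) c) -[RHS]/(psi c).
apply: linear_eq_gen => s /=; rewrite bd_gen.
have [n] := ubnP (size s); elim: n s => // n IHn s sn.
rewrite cone_homotopy_gen bd_cone linearB /= bd_g bd_gen.
suff -> : bd (cone_homotopy (list_boundary s)) =
    g (list_boundary s) - cone_homotopy (bd (list_boundary s)).
  by rewrite -[list_boundary s]bd_gen bd_bd linear0 subr0 subrr linear0 subr0.
rewrite -[LHS]/((bd \o cone_homotopy) (list_boundary s)).
rewrite -[RHS]/(psi (list_boundary s)).
apply: (linear_eq_supported (A := fun t => (size t < n)%N)) => /=.
  by move=> t /IHn ->; rewrite bd_gen.
apply: supported_list_boundary => j js.
by rewrite size_del //; case: (size s) js sn.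
Qed.

Lemma supported_cone_homotopy (A A' : seq P -> seq Q -> Prop) :
  (forall s j t, (j < size s)%N -> A' (del j s) t -> A' s (apex s :: t)) ->
  (forall s t, A s t -> A' s (apex s :: t)) ->
  (forall s, supported (A s) (g (gen F s))) ->
  forall s, supported (A' s) (cone_homotopy (gen F s)).
Proof.
move=> A1 A2 Ag; apply: supported_cone_rec => // s.
by apply: supported_cone (Ag s) => t; apply: A2.
Qed.

End Homotopy.

Lemma cone_homotopy_natural (P P' Q Q' : choiceType) (phi : P -> P') (psi : Q -> Q')
    (g : {linear {free F[seq P]} -> {free F[seq Q]}})
    (g' : {linear {free F[seq P']} -> {free F[seq Q']}})
    (apex : seq P -> Q) (apex' : seq P' -> Q') :
  (forall c, g' (lmap phi c) = lmap psi (g c)) ->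
  (forall s, s != [::] -> apex' (map phi s) = psi (apex s)) ->
  g (gen F [::]) = 0 ->
  forall c, cone_homotopy g' apex' (lmap phi c) = lmap psi (cone_homotopy g apex c).
Proof.
move=> gg' aa' g0; apply: cone_rec_natural => // s.
rewrite -lmap_gen gg' lmap_cone; case: (eqVneq s [::]) => [->|s0].
  by rewrite g0 !linear0.
by rewrite aa'.
Qed.

End ConeRecursion.

(** * Orientation of ordered simplices *)

Section Orientation.
Variables (F : fieldType) (V : finType).
Implicit Types (v w : V) (s t : seq V) (c : {free F[seq V]}).

(** This is the order of [enum], by which simplices are oriented, so increasing lists are exactly
    the enumerations of vertex sets ([sorted_enum], [enum_sorted]). *)
Definition vlt v w : bool := (enum_rank v < enum_rank w)%N.

Lemma vlt_trans : transitive vlt. Proof. by move=> ? ? ?; apply: ltn_trans. Qed.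

Lemma vlt_irr : irreflexive vlt. Proof. by move=> v; apply: ltnn. Qed.

(** Left multiplication by [v] in the exterior algebra on [V], on the basis of
    increasing lists. *)
Fixpoint insert v s : {free F[seq V]} :=
  if s is w :: s' then
    if vlt v w then gen F (v :: s)
    else if v == w then 0 else - cone w (insert v s')
  else gen F [:: v].

Definition insert_ext v : {free F[seq V]} -> {free F[seq V]} := lin_ext (insert v).
HB.instance Definition _ v := GRing.Linear.on (insert_ext v).

Lemma insert_ext_gen v s : insert_ext v (gen F s) = insert v s.
Proof. exact: lin_ext_gen. Qed.

Lemma insert_lt v s : path vlt v s -> insert v s = gen F (v :: s).
Proof. by case: s => [//|w s] /= /andP[->]. Qed.

Lemma insert_ext_lt v c :
  supported (fun t => all (vlt v) t) c -> insert_ext v c = cone v c.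
Proof.
apply: linear_eq_supported => -[|w s] /=; rewrite cone_gen insert_ext_gen //.
by move=> /andP[/= ->].
Qed.

Lemma insert_ext_cone_eq v c : insert_ext v (cone v c) = 0.
Proof.
pose psi : {linear {free F[seq V]} -> {free F[seq V]}} := \0.
rewrite -[RHS]/(psi c) -[LHS]/((insert_ext v \o cone v) c).
by apply: linear_eq_gen => s; rewrite /= cone_gen insert_ext_gen /= vlt_irr eqxx.
Qed.

Lemma insert_ext_cone_gt v w c :
  vlt w v -> insert_ext v (cone w c) = - cone w (insert_ext v c).
Proof.
move=> wv.
pose psi : {linear {free F[seq V]} -> {free F[seq V]}} :=
  \- (cone w \o insert_ext v).
rewrite -[RHS]/(psi c) -[LHS]/((insert_ext v \o cone w) c).
apply: linear_eq_gen => s; rewrite /= cone_gen !insert_ext_gen /=.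
rewrite /vlt ltnNge (ltnW wv) /=; case: eqVneq => // vw.
by move: wv; rewrite vw vlt_irr.
Qed.

Lemma supported_insert v s : sorted vlt s ->
  supported (fun t => sorted vlt t && perm_eq t (v :: s)) (insert v s).
Proof.
elim: s => [_|w s IHs /= ps]; first by apply: supported_gen; rewrite perm_refl.
case: ifP => vw; first by apply: supported_gen; rewrite /= vw ps perm_refl.
case: eqVneq => [_|v_neq_w]; first exact: supported0.
have wv : vlt w v.
  rewrite /vlt ltn_neqAle leqNgt (negbT vw) andbT.
  by rewrite (inj_eq val_inj) (inj_eq enum_rank_inj) eq_sym.
apply: supportedN; apply: (supported_cone (A := fun t => sorted vlt t && perm_eq t (v :: s))).
  move=> t /andP[st pt]; rewrite /= path_sortedE; last exact: vlt_trans.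
  rewrite st (perm_all _ pt) /= wv andbT order_path_min //=; last exact: vlt_trans.
  by rewrite -(perm_cons w) in pt; apply: perm_trans pt _; apply/permP => a /=; rewrite addnCA.
by apply: IHs; apply: path_sorted ps.
Qed.

(** On the exterior algebra [bd] is the antiderivation that sends every vertex to 1, and this is its
    Leibniz rule for a product with [v]. *)
Lemma bd_insert v s : sorted vlt s ->
  bd (insert v s) = gen F s - insert_ext v (list_boundary s).
Proof.
elim: s => [_|w s IHs /= ps]; first by rewrite bd_gen /= !linear0.
have all_bd u : path vlt u s -> supported (fun t => all (vlt u) t) (list_boundary s).
  move=> us; apply: supported_list_boundary => j _.
  apply/allP => x /(mem_subseq (subseq_del j s)) xs.
  exact: (allP (order_path_min vlt_trans us)).
rewrite linearB /= insert_ext_gen.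
case: ifP => vw.
  have vs : path vlt v s by apply: (path_le vlt_trans vw).
  have vws : path vlt v (w :: s) by rewrite /= vw.
  rewrite insert_lt // bd_gen /= linearB /= cone_gen.
  congr (_ - (_ - _)); rewrite insert_ext_lt //.
  apply: (supported_cone (A := fun t => all (vlt v) t)); first by move=> t /= ->; rewrite vw.
  exact: all_bd.
(* If [v = w] the product is 0; on the right, the term where [v] meets itself vanishes and the other
   two cancel. *)
case: eqVneq => [<-|v_neq_w] in ps *.
  by rewrite linear0 insert_ext_cone_eq subr0 insert_lt // subrr.
have wv : vlt w v.
  rewrite /vlt ltn_neqAle leqNgt (negbT vw) andbT.
  by rewrite (inj_eq val_inj) (inj_eq enum_rank_inj) eq_sym.
rewrite linearN /= bd_cone IHs; last exact: path_sorted ps.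
rewrite insert_ext_cone_gt // (linearB (cone w)) /= cone_gen.
by rewrite opprB opprK opprD addrA addrAC.
Qed.

(** The exterior product of the entries of [s]: 0 if an entry repeats, and otherwise the sorted list
    with the sign of the sorting permutation. *)
Fixpoint orient s : {free F[seq V]} :=
  if s is v :: s' then insert_ext v (orient s') else gen F [::].

Definition orient_ext : {free F[seq V]} -> {free F[seq V]} := lin_ext orient.
HB.instance Definition _ := GRing.Linear.on orient_ext.

Lemma orient_ext_gen s : orient_ext (gen F s) = orient s.
Proof. exact: lin_ext_gen. Qed.

Lemma orient_ext_cone v c : orient_ext (cone v c) = insert_ext v (orient_ext c).
Proof.
rewrite -[LHS]/((orient_ext \o cone v) c) -[RHS]/((insert_ext v \o orient_ext) c).
by apply: linear_eq_gen => s; rewrite /= cone_gen !orient_ext_gen.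
Qed.

Lemma supported_orient s :
  supported (fun t => sorted vlt t && perm_eq t s) (orient s).
Proof.
elim: s => [|v s IHs] /=; first exact: supported_gen.
apply: supported_lin_ext IHs => t /andP[st pt].
apply: (sub_supported _ (supported_insert st)) => u /andP[-> pu].
by apply: perm_trans pu _; rewrite perm_cons.
Qed.

Lemma bd_insert_ext v c : supported (fun t => sorted vlt t) c ->
  bd (insert_ext v c) = c - insert_ext v (bd c).
Proof.
pose psi : {linear {free F[seq V]} -> {free F[seq V]}} :=
  idfun \- (insert_ext v \o bd).
rewrite -[c - _]/(psi c) -[bd _]/((bd \o insert_ext v) c).
by apply: linear_eq_supported => s ss; rewrite /= insert_ext_gen bd_insert ?bd_gen.
Qed.

Lemma bd_orient c : bd (orient_ext c) = orient_ext (bd c).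
Proof.
rewrite -[LHS]/((bd \o orient_ext) c) -[RHS]/((orient_ext \o bd) c).
apply: linear_eq_gen => s /=; rewrite orient_ext_gen bd_gen.
elim: s => [|v s IHs] /=; first by rewrite bd_gen linear0.
rewrite linearB /= orient_ext_cone -IHs orient_ext_gen bd_insert_ext //.
by apply: (sub_supported _ (@supported_orient s)) => t /andP[].
Qed.

Lemma orient_sorted s : sorted vlt s -> orient s = gen F s.
Proof.
elim: s => [//|v s IHs] /= vs; rewrite IHs; last exact: path_sorted vs.
by rewrite insert_ext_gen insert_lt.
Qed.

Lemma sorted_enum (A : {set V}) : sorted vlt (enum A).
Proof.
apply: (subseq_sorted vlt_trans (s2 := enum V)).
  by rewrite !enumT; exact: filter_subseq.
have [->//|[v0 _]] : enum V = [::] \/ exists v : V, True.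
  by case: (enum V) => [|v s]; [left | right; exists v].
have rank_nth i (iV : (i < #|V|)%N) : enum_rank (nth v0 (enum V) i) = i :> nat.
  by rewrite -(enum_val_nth v0 (Ordinal iV)) enum_valK.
apply/(sortedP v0) => i; rewrite -cardE => iV.
by rewrite /vlt !rank_nth // ltnW.
Qed.

Lemma enum_sorted s : sorted vlt s -> enum [set v in s] = s.
Proof.
move=> ss; apply: (irr_sorted_eq vlt_trans vlt_irr (sorted_enum _) ss) => v.
by rewrite mem_enum inE.
Qed.

End Orientation.

(** * Barycentric subdivision *)

Lemma sumr_const_seq (V : nmodType) (T : Type) (s : seq T) (x : V) :
  \sum_(i <- s) x = x *+ size s.
Proof. by rewrite big_const_seq count_predT iter_addr_0. Qed.

Section Subdivision.
Variables (F : fieldType) (R : realFieldType).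

Section Barycenter.
Variable P : lmodType R.
Implicit Types (p q : P) (s t : seq P) (C : P -> Prop) (phi : {linear P -> R^o}).

Definition barycenter s : P := (size s)%:R^-1 *: \sum_(p <- s) p.

(** A weak form of convexity: subdivision creates no points other than barycenters, and half-spaces
    already satisfy it. *)
Definition barycenter_closed C : Prop :=
  forall s, s != [::] -> {in s, forall p, C p} -> C (barycenter s).

Lemma linear_barycenter (Q : lmodType R) (A : {linear P -> Q}) s :
  A (barycenter s) = (size s)%:R^-1 *: \sum_(p <- s) A p.
Proof. by rewrite linearZ linear_sum. Qed.

Lemma barycenter_closed_ge phi (x : R) : barycenter_closed (fun p => x <= phi p).
Proof.
move=> s s0 sx; have s_gt0 : 0 < (size s)%:R :> R by rewrite ltr0n lt0n size_eq0.
rewrite linear_barycenter /= -[_ *: _]/(_ * _) mulrC ler_pdivlMr // mulrC.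
rewrite mulr_natl -sumr_const_seq big_seq [leRHS]big_seq.
exact: ler_sum.
Qed.

Lemma barycenter_closed_le phi (x : R) : barycenter_closed (fun p => phi p <= x).
Proof.
move=> s s0 sx; pose psi : {linear P -> R^o} := \- phi.
have := @barycenter_closed_ge psi (- x) s s0; rewrite /= lerN2; apply.
by move=> p /sx; rewrite /= lerN2.
Qed.

(** The width of [s] in the direction [phi]. Since [p] and [q] may be exchanged, the one-sided bound
    controls the absolute value; directions replace a norm on [P]. *)
Definition spread phi (d : R) s : Prop := {in s &, forall p q, phi p - phi q <= d}.

(** In the average of [phi q - phi p] over [q] in [s] the term [q = p] vanishes. With [k = size s]
    this leaves at most [(k - 1) / k * d], and [(k - 1) / k] increases with [k]. *)
Lemma barycenter_spread N phi d s p : (size s <= N.+1)%N -> spread phi d s ->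
  p \in s -> phi (barycenter s) - phi p <= N%:R / N.+1%:R * d.
Proof.
move=> sN sd ps.
have d0 : 0 <= d by have := sd p p ps ps; rewrite subrr.
have s_gt0 : (0 < size s)%N by case: (s) ps.
have sR_gt0 : 0 < (size s)%:R :> R by rewrite ltr0n.
have sR_neq0 : (size s)%:R != 0 :> R by rewrite gt_eqF.
rewrite linear_barycenter -[_ *: _]/(_ * _).
have -> : phi p = (size s)%:R^-1 * \sum_(q <- s) phi p.
  by rewrite sumr_const_seq -[in RHS](mulr_natl (phi p)) mulKf.
rewrite -mulrBr -sumrB (big_rem p) //= subrr add0r.
apply: (@le_trans _ _ ((size s)%:R^-1 * ((size s).-1%:R * d))).
  rewrite ler_pM2l ?invr_gt0 // -(size_rem ps) mulr_natl.
  rewrite -sumr_const_seq big_seq [leRHS]big_seq.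
  by apply: ler_sum => q /mem_rem qs; apply: sd.
rewrite mulrA ler_wpM2r // mulrC ler_pdivrMr // mulrAC ler_pdivlMr ?ltr0n //.
rewrite -!natrM ler_nat; case: (size s) s_gt0 sN => //= m _ mN.
by rewrite !mulnS [(N * m)%N]mulnC leq_add2r.
Qed.

End Barycenter.

Lemma barycenter_map (P Q : lmodType R) (A : {linear P -> Q}) (s : seq P) :
  barycenter (map A s) = A (barycenter s).
Proof. by rewrite linear_barycenter /barycenter size_map big_map. Qed.

Section SubdivisionOperator.
Variable P : lmodType R.
Implicit Types (s t : seq P) (c : {free F[seq P]}) (C : P -> Prop).

Definition sd : {free F[seq P]} -> {free F[seq P]} := cone_map (@barycenter P).
HB.instance Definition _ := GRing.Linear.on sd.

Definition sd_iter k : {free F[seq P]} -> {free F[seq P]} := iter k sd.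

Lemma sd_iter_is_linear k : linear (sd_iter k).
Proof. by move=> a x y; elim: k => //= k ->; rewrite linearP. Qed.

HB.instance Definition _ k := GRing.isLinear.Build F _ _ _ (sd_iter k)
  (sd_iter_is_linear k).

Lemma bd_sd_iter k c : bd (sd_iter k c) = sd_iter k (bd c).
Proof. by elim: k => //= k <-; rewrite [LHS]bd_cone_map. Qed.

Lemma sd_iter_nil k : sd_iter k (gen F [::]) = gen F [::].
Proof. by elim: k => //= k ->; rewrite /sd cone_map_gen. Qed.

(** [N] bounds the size instead of fixing it, so that one factor [rho] serves a simplex together
    with all its faces. Quantifying over [C] says that [t] lies in the hull of [s] without a
    definition of hulls. *)
Definition shrunk N (rho : R) s t : Prop :=
  [/\ size t = size s,
      forall C, barycenter_closed C -> {in s, forall p, C p} ->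
        {in t, forall p, C p}
    & (size s <= N.+1)%N ->
        forall phi d, spread phi d s -> spread phi (rho * d) t].

Lemma supported_sd N s :
  supported (shrunk N (N%:R / N.+1%:R) s) (sd (gen F s)).
Proof.
move: s; apply: supported_cone_rec => [s j t js [szt hull_t spread_t]|]; last first.
  case=> [|p s]; last exact: supported0.
  by apply: supported_gen; split.
have del_in : {subset del j s <= s} by apply: mem_subseq; apply: subseq_del.
have s0 : s != [::] by case: (s) js.
split=> [|C bC sC|sN phi d sd_s].
- by rewrite /= szt size_del // prednK // (leq_trans _ js).
- move=> p; rewrite in_cons => /orP[/eqP->|]; first exact: bC.
  by apply: hull_t => // q /del_in; apply: sC.
(* For a fixed barycenter the bound is a half-space condition on [q]; it holds at the vertices of
   [s], hence on the hull, which contains [t]. *)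
have spread_q psi : spread psi d s ->
    forall q, q \in t -> psi (barycenter s) - psi q <= N%:R / N.+1%:R * d.
  move=> sd_psi q qt; rewrite lerBlDr addrC -lerBlDr.
  apply: (hull_t _ (@barycenter_closed_ge _ psi _)) q qt => q /del_in qs.
  by rewrite lerBlDr addrC -lerBlDr barycenter_spread.
have d0 : 0 <= d.
  by case: (s) s0 sd_s => // p s' _ /(_ p p (mem_head _ _) (mem_head _ _)); rewrite subrr.
(* The opposite functional gives the same bound for the reversed difference. *)
pose psi : {linear P -> R^o} := \- phi.
have sd_psi : spread psi d s.
  by move=> p q ps qs; rewrite /= opprK addrC; apply: sd_s.
move=> p q; rewrite !in_cons => /orP[/eqP->|pt] /orP[/eqP->|qt].
- by rewrite subrr mulr_ge0 // divr_ge0 ?ler0n.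
- exact: spread_q.
- by have := spread_q psi sd_psi p pt; rewrite /= opprK addrC.
apply: spread_t => //.
  by rewrite size_del // (leq_trans (leq_pred _)).
by move=> p' q' /del_in ps /del_in qs; apply: sd_s.
Qed.

Lemma supported_sd_iter N k s :
  supported (shrunk N ((N%:R / N.+1%:R) ^+ k) s) (sd_iter k (gen F s)).
Proof.
elim: k => [|k IHk] /=.
  by apply: supported_gen; split=> // sN phi d; rewrite mul1r.
rewrite -[sd_iter k _]free_ext_id linear_free_ext.
apply: supported_ext IHk => t [szt hull_t spread_t] u /= /(@supported_sd N).
move=> [szu hull_u spread_u]; split=> [|C bC /(hull_t C bC)|sN phi d].
- by rewrite szu.
- exact: hull_u.
by move=> /(spread_t sN)/spread_u; rewrite szt exprS mulrA; apply.
Qed.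

(** The first vertex as apex is natural under linear maps and stays in every set that contains the
    vertices. The default of [head] occurs only for the empty list, where the homotopy vanishes. *)
Definition sd_homotopy k : {free F[seq P]} -> {free F[seq P]} :=
  cone_homotopy (idfun \- sd_iter k) (head 0).
HB.instance Definition _ k := GRing.Linear.on (sd_homotopy k).

Lemma sd_homotopy_nil k : sd_homotopy k (gen F [::]) = 0.
Proof. by apply: cone_homotopy_nil; rewrite /= sd_iter_nil subrr. Qed.

Lemma bd_sd_homotopy k c :
  bd (sd_homotopy k c) = c - sd_iter k c - sd_homotopy k (bd c).
Proof.
by apply: bd_cone_homotopy => {}c; rewrite /= linearB /= bd_sd_iter.
Qed.

Lemma supported_sd_homotopy k s :
  supported (fun t => size t = (size s).+1 /\
      forall C, barycenter_closed C -> {in s, forall p, C p} ->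
        {in t, forall p, C p})
    (sd_homotopy k (gen F s)).
Proof.
pose A s t := [/\ s != [::], size t = size s &
  forall C, barycenter_closed C -> {in s, forall p, C p} -> {in t, forall p, C p}].
move: s; apply: (supported_cone_homotopy (A := A)) => [s j t js [szt hull_t]|s t|s].
- split=> [|C bC sC p]; first by rewrite /= szt size_del // prednK // (leq_trans _ js).
  rewrite in_cons => /orP[/eqP->|].
    by apply: sC; case: (s) js => //= q s' _; rewrite mem_head.
  apply: hull_t => // q /(mem_subseq (subseq_del _ _)); exact: sC.
- move=> [s0 szt hull_t]; split=> [|C bC sC p]; first by rewrite /= szt.
  rewrite in_cons => /orP[/eqP->|]; last exact: hull_t.
  by apply: sC; case: (s) s0 => //= q s' _; rewrite mem_head.
case: (eqVneq s [::]) => [->|s0].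
  by rewrite /= sd_iter_nil subrr; apply: supported0.
apply: supportedB; first by apply: supported_gen.
by apply: (sub_supported _ (@supported_sd_iter 0 k s)) => t [].
Qed.

End SubdivisionOperator.

Section SubdivisionNatural.
Variables (P Q : lmodType R) (A : {linear P -> Q}).
Implicit Type c : {free F[seq P]}.

Lemma sd_iter_natural k c : sd_iter k (lmap A c) = lmap A (sd_iter k c).
Proof.
elim: k => //= k ->; apply: cone_rec_natural => [[|p s]|s _] /=.
- by rewrite lmap_gen.
- by rewrite linear0.
exact: barycenter_map.
Qed.

Lemma sd_homotopy_natural k c :
  sd_homotopy k (lmap A c) = lmap A (sd_homotopy k c).
Proof.
apply: cone_homotopy_natural => [{}c|s s0|] /=.
- by rewrite sd_iter_natural linearB.
- by case: s s0.
by rewrite sd_iter_nil subrr.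
Qed.

End SubdivisionNatural.

End Subdivision.

(** * Weighted simplicial chains *)

Section WeightedSimplices.
Variables (F : fieldType) (V : finType) (W : weighted_complex V).
Hypothesis weight_neq0 : forall s, s \in W -> (weight W s)%:R != 0 :> F.

(** Over [F] the weighted complex is isomorphic to the unweighted one, via the
    rescaling of each simplex by this unit. *)
Definition rescaling (s : {set V}) : F :=
  if wtype W is Ascending then (weight W s)%:R else (weight W s)%:R^-1.

Lemma rescaling_neq0 s : s \in W -> rescaling s != 0.
Proof.
by rewrite /rescaling => /weight_neq0; case: (wtype W); rewrite ?invr_eq0.
Qed.

Definition to_lists n : {free F[nsimplex W n]} -> {free F[seq V]} :=
  lin_ext (fun s : nsimplex W n => rescaling (val s) *: gen F (enum (val s))).
HB.instance Definition _ n := GRing.Linear.on (@to_lists n).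

Lemma to_lists_gen n (s : nsimplex W n) :
  to_lists (gen F s) = rescaling (val s) *: gen F (enum (val s)).
Proof. exact: lin_ext_gen. Qed.

Definition simplex_list n (l : seq V) : Prop :=
  [/\ sorted (@vlt V) l, size l = n.+1 & [set v in l] \in W].

Lemma supported_to_lists n (c : {free F[nsimplex W n]}) :
  supported (simplex_list n) (to_lists c).
Proof.
apply: (supported_lin_ext (A := fun=> True)) => // s _; apply: supportedZ.
have /andP[sW /eqP s_card] := valP s.
apply: supported_gen; split; first exact: sorted_enum.
  by rewrite -cardE.
suff -> : [set v in enum (val s)] = val s by [].
by apply/setP => v; rewrite inE mem_enum.
Qed.

(** The weight quotients are exact by divisibility. With [c] the coefficient, [c * mu(face) = mu(s)]
    in the ascending case and [c / mu(face) = 1 / mu(s)] in the descending one, so the rescaling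
    absorbs [c]. *)
Lemma face_coef_rescaling n (j : 'I_n.+2) (s : nsimplex W n.+1) :
  (face_coef j s)%:R * rescaling (val (face j s)) = rescaling (val s).
Proof.
have sub : val (face j s) \subset val s.
  apply/fintype.subsetP => v; rewrite inE => /(mem_subseq (subseq_del _ _)).
  by rewrite mem_enum.
have /andP[sW _] := valP s; have /andP[fW _] := valP (face j s).
have := weight_face sW fW sub.
have := weight_neq0 sW; have := weight_neq0 fW.
rewrite /face_coef /rescaling /weight_le.
case: (wtype W) => f0 s0 dv; first by rewrite -natrM divnK.
apply: (mulIf f0); rewrite mulfVK //; apply: (mulfI s0).
by rewrite -natrM mulnC divnK // mulVKf.
Qed.

Lemma bd_to_lists n (c : {free F[nsimplex W n.+1]}) :
  bd (to_lists c) = to_lists (free_ext (@weighted_boundary F V W n) c).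
Proof.
rewrite -[LHS]/((bd \o @to_lists n.+1) c).
rewrite -[RHS]/((@to_lists n \o free_ext (@weighted_boundary F V W n)) c).
apply: linear_eq_gen => s /=.
rewrite to_lists_gen linearZ /= bd_gen list_boundaryE free_ext_gen.
rewrite /weighted_boundary !linear_sum /=.
have /andP[_ /eqP s_card] := valP s.
rewrite -cardE s_card; apply: eq_bigr => j _.
rewrite [RHS]linearZ /= to_lists_gen !scalerA enum_face; congr (_ *: _).
by rewrite -mulrA face_coef_rescaling mulrC.
Qed.

(** The default 0 is never met on chains supported by [simplex_list n], where this inverts
    [to_lists]. *)
Definition of_lists n : {free F[seq V]} -> {free F[nsimplex W n]} :=
  lin_ext (fun l : seq V =>
    if insub [set v in l] : option (nsimplex W n) is Some s
    then (rescaling (val s))^-1 *: gen F s else 0).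
HB.instance Definition _ n := GRing.Linear.on (@of_lists n).

Lemma to_listsK n (c : {free F[nsimplex W n]}) : of_lists n (to_lists c) = c.
Proof.
rewrite -[LHS]/((@of_lists n \o @to_lists n) c) -[RHS]/(idfun c).
apply: linear_eq_gen => s /=; rewrite to_lists_gen linearZ /= [of_lists _ _]lin_ext_gen.
have -> : [set v in enum (val s)] = val s by apply/setP => v; rewrite inE mem_enum.
rewrite valK scalerA mulfV ?scale1r // rescaling_neq0 //.
by have /andP[] := valP s.
Qed.

Lemma of_listsK n c : supported (simplex_list n) c -> to_lists (of_lists n c) = c.
Proof.
rewrite -[to_lists _]/((@to_lists n \o @of_lists n) c) -[RHS]/(idfun c).
apply: linear_eq_supported => l [ls l_size lW] /=; rewrite [of_lists _ _]lin_ext_gen.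
have enum_l := enum_sorted ls.
have lP : ([set v in l] \in W) && (#|[set v in l]| == n.+1).
  by rewrite lW cardE enum_l l_size eqxx.
rewrite insubT linearZ /= to_lists_gen scalerA /= enum_l mulVf ?scale1r //.
exact: rescaling_neq0.
Qed.

End WeightedSimplices.

(** * Simplices and convex combinations *)

Lemma continuous_ptws (R : realType) (T : topologicalType) (U : Type)
    (f : T -> {ptws U -> R}) :
  (forall u, continuous (fun t => f t u)) -> continuous f.
Proof.
move=> f_cont x; have FF : Filter (f z @[z --> x])%classic by apply: fmap_filter.
apply/cvg_sup => u.
exact: (@continuous_comp_initial _ _ _ (fun y : {ptws U -> R} => y u) f (f_cont u)).
Qed.

Section FullSimplex.
Variables (R : realType) (U : finType).

Lemma barycentric_continuous (u : U) :
  continuous (fun y : full_simplex R U => (val y : {ptws U -> R}) u).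
Proof.
move=> z; exact: (continuous_comp (@initial_continuous _ _ set_val z)
  (@proj_continuous _ _ u _)).
Qed.

Lemma full_simplexP (y : full_simplex R U) : full_simplex R U (val y).
Proof. exact: set_mem (valP y). Qed.

Definition linear_coord (u : U) (x : U -> R^o) : R^o := x u.

Lemma linear_coord_is_linear u : linear (linear_coord u).
Proof. by []. Qed.

HB.instance Definition _ u := GRing.isLinear.Build R (U -> R^o) R^o _
  (linear_coord u) (linear_coord_is_linear u).

Definition linear_mass (x : U -> R^o) : R^o := \sum_u x u.

Lemma linear_mass_is_linear : linear linear_mass.
Proof.
by move=> a x y; rewrite /linear_mass scaler_sumr -big_split.
Qed.

HB.instance Definition _ := GRing.isLinear.Build R (U -> R^o) R^o _
  linear_mass linear_mass_is_linear.

(** The simplex is an intersection of half-spaces, the equation for the sum being two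
    inequalities. *)
Lemma full_simplex_barycenter_closed :
  barycenter_closed (fun x : U -> R^o => full_simplex R U x).
Proof.
move=> s s0 sD; split=> [u|].
  by apply: (barycenter_closed_ge (phi := linear_coord u)) => // x /sD[+ _]; apply.
apply/eqP; rewrite eq_le; apply/andP; split.
  apply: (barycenter_closed_le (phi := linear_mass)) => // x /sD[_ /eqP].
  by rewrite eq_le => /andP[].
apply: (barycenter_closed_ge (phi := linear_mass)) => // x /sD[_ /eqP].
by rewrite eq_le => /andP[].
Qed.

Definition vertex (u : U) : U -> R^o := fun v => (v == u)%:R.

Lemma vertex_full_simplex u : full_simplex R U (vertex u).
Proof.
split=> [v|]; first by rewrite /vertex ler0n.
rewrite (bigD1 u) //= {1}/vertex eqxx big1 ?addr0 // => v /negPf vu.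
by rewrite /vertex vu.
Qed.

End FullSimplex.

Arguments vertex R {U}.

Section Pushforward.
Variables (R : realType) (U U' : finType) (f : U -> U').

Definition pushforward (x : U -> R^o) : U' -> R^o := push f (x : {ptws U -> R}).

Lemma pushforward_is_linear : linear pushforward.
Proof.
move=> a x y; apply/funext => i; rewrite /pushforward /push.
rewrite -[RHS]/(a *: (\sum_(k | f k == i) x k) + \sum_(k | f k == i) y k).
by rewrite scaler_sumr -big_split.
Qed.

HB.instance Definition _ := GRing.isLinear.Build R (U -> R^o) (U' -> R^o) _
  pushforward pushforward_is_linear.

Lemma pushforward_vertex u : pushforward (vertex R u) = vertex R (f u).
Proof.
apply/funext => k; rewrite /pushforward /push /vertex big_mkcond (bigD1 u) //= eqxx.
rewrite big1 => [|v /negPf vu]; first by rewrite addr0 eq_sym; case: eqP.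
by rewrite vu; case: ifP.
Qed.

End Pushforward.

Lemma pushforward_comp (R : realType) (U U' U'' : finType) (f : U' -> U'')
    (g : U -> U') (x : U -> R^o) :
  pushforward f (pushforward g x) = pushforward (f \o g) x.
Proof.
apply/funext => v; rewrite /pushforward /push.
rewrite [RHS](partition_big g (fun v' => f v' == v)) //=.
apply: eq_bigr => v' /eqP fv'; apply: eq_bigl => u.
by case: eqP => [->|_]; rewrite ?andbF // andbT fv' eqxx.
Qed.

Section Combination.
Variables (R : realType) (P : lmodType R).
Implicit Types (s : seq P).

Definition comb m s (y : full_simplex R 'I_m.+1) : P :=
  \sum_(i < m.+1) (val y : {ptws 'I_m.+1 -> R}) i *: s`_i.

Lemma nth_del j s (k : nat) : (j < size s)%N -> (del j s)`_k = s`_(bump j k).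
Proof.
move=> js; rewrite /del nth_cat size_takel; last exact: ltnW.
rewrite /bump; case: (ltnP k j) => kj; first by rewrite nth_take.
by rewrite nth_drop addSn subnKC.
Qed.

Lemma comb_face m (j : 'I_m.+2) s (y : full_simplex R 'I_m.+1) :
  size s = m.+2 -> comb s (simplex_map (lift j) y) = comb (del j s) y.
Proof.
move=> sm; rewrite /comb /= /push [RHS](partition_big (lift j) xpredT) //=.
apply: eq_bigr => i _; rewrite scaler_suml; apply: eq_bigr => k /eqP <-.
by rewrite nth_del // sm.
Qed.

End Combination.

Lemma comb_map (R : realType) (P Q : lmodType R) (A : {linear P -> Q}) m (s : seq P)
    (y : full_simplex R 'I_m.+1) :
  size s = m.+1 -> comb (map A s) y = A (comb s y).
Proof.
move=> sm; rewrite linear_sum; apply: eq_bigr => i _.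
by rewrite linearZ (nth_map 0) ?sm.
Qed.

Section LinearCombination.
Variables (R : realType) (P : lmodType R) (phi : {linear P -> R^o}).

Lemma linear_comb m (s : seq P) (y : full_simplex R 'I_m.+1) :
  phi (comb s y) = \sum_(i < m.+1) (val y : {ptws 'I_m.+1 -> R}) i * phi s`_i.
Proof. by rewrite linear_sum; apply: eq_bigr => i _; rewrite linearZ. Qed.

Lemma comb_le m (s : seq P) (y : full_simplex R 'I_m.+1) x : size s = m.+1 ->
  {in s, forall p, phi p <= x} -> phi (comb s y) <= x.
Proof.
move=> sm sx; have [y0 y1] := full_simplexP y.
rewrite linear_comb -[x]mul1r -y1 mulr_suml; apply: ler_sum => i _.
by apply: ler_wpM2l => //; apply: sx; rewrite mem_nth ?sm.
Qed.

Lemma comb_ge m (s : seq P) (y : full_simplex R 'I_m.+1) x : size s = m.+1 ->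
  {in s, forall p, x <= phi p} -> x <= phi (comb s y).
Proof.
move=> sm sx; have [y0 y1] := full_simplexP y.
rewrite linear_comb -[x]mul1r -y1 mulr_suml; apply: ler_sum => i _.
by apply: ler_wpM2l => //; apply: sx; rewrite mem_nth ?sm.
Qed.

Lemma comb_spread m (s : seq P) (y z : full_simplex R 'I_m.+1) d :
  size s = m.+1 -> spread phi d s -> phi (comb s y) - phi (comb s z) <= d.
Proof.
move=> sm sd; rewrite lerBlDr; apply: comb_le => // p ps.
rewrite -lerBlDl; apply: comb_ge => // q qs.
by rewrite lerBlDl -lerBlDr; apply: sd.
Qed.

Lemma linear_comb_continuous m (s : seq P) :
  continuous (fun y : full_simplex R 'I_m.+1 => phi (comb s y) : R).
Proof.
have -> : (fun y : full_simplex R 'I_m.+1 => phi (comb s y) : R) =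
    (fun y => \sum_(i < m.+1) (val y : {ptws 'I_m.+1 -> R}) i * phi s`_i).
  by apply/funext => y; rewrite linear_comb.
apply: (@continuous_big R _ +%R 0 _ (@add_continuous R)) => i _ y.
apply: continuousM; first exact: barycentric_continuous.
exact: cst_continuous.
Qed.

End LinearCombination.

Section CombFunctions.
Variables (R : realType) (U : finType).
Implicit Types (s : seq (U -> R^o)).

Lemma combE m s (y : full_simplex R 'I_m.+1) u :
  comb s y u = \sum_(i < m.+1) (val y : {ptws 'I_m.+1 -> R}) i * s`_i u.
Proof. exact: (linear_comb (linear_coord u)). Qed.

Lemma comb_continuous m s :
  continuous (fun y : full_simplex R 'I_m.+1 => (comb s y : {ptws U -> R})).
Proof.
apply: continuous_ptws => u.
exact: (@linear_comb_continuous _ _ (linear_coord u) m s).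
Qed.

Lemma comb_full_simplex m s (y : full_simplex R 'I_m.+1) : size s = m.+1 ->
  {in s, forall x, full_simplex R U x} -> full_simplex R U (comb s y).
Proof.
move=> sm sD; have [y0 y1] := full_simplexP y.
have sD_nth (i : 'I_m.+1) : full_simplex R U s`_i by apply: sD; rewrite mem_nth ?sm.
split=> [u|].
  by rewrite combE sumr_ge0 // => i _; rewrite mulr_ge0 //; apply: (sD_nth i).1.
rewrite (eq_bigr _ (fun u _ => combE s y u)).
rewrite exchange_big /= -[RHS]y1; apply: eq_bigr => i _.
by rewrite -mulr_sumr (sD_nth i).2 mulr1.
Qed.

End CombFunctions.

(** * Affine chains in singular chains *)

Section SingularPush.
Variables (R : realType) (F : fieldType) (V : finType) (K : simplicial_complex V).

Local Notation polyhedron := (classical_sets.set_type (@realization R V K)).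
Local Notation simplex m := (full_simplex R 'I_m.+1).
Local Notation singular m := (continuousType (simplex m) polyhedron).
Local Notation singular_bd m := (free_ext (@singular_boundary R F polyhedron m)).

Definition into_polyhedron m (f : simplex m -> {ptws V -> R}) : Prop :=
  continuous f /\ forall y, realization K (f y).

Section SingularOf.
Variables (m : nat) (f : simplex m -> {ptws V -> R}).
Hypothesis fK : into_polyhedron f.

Lemma corestriction_subproof y : f y \in @realization R V K.
Proof. exact/mem_set/fK.2. Qed.

Definition corestriction (y : simplex m) : polyhedron :=
  exist _ (f y) (corestriction_subproof y).

Lemma corestriction_continuous : continuous corestriction.
Proof. by apply: continuous_comp_initial; apply: fK.1. Qed.

HB.instance Definition _ :=
  @isContinuous.Build _ _ corestriction corestriction_continuous.

Definition singular_of : singular m := corestriction.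

End SingularOf.

(** The value 0 on maps that are discontinuous or leave the polyhedron makes this total, so
    operators can be written without carrying proofs; the supports supply [into_polyhedron] where it
    matters. *)
Definition singular_gen m (f : simplex m -> {ptws V -> R}) : {free F[singular m]} :=
  if pselect (into_polyhedron f) is left fK then gen F (singular_of fK) else 0.

Lemma singular_genE m (f : simplex m -> {ptws V -> R}) (s : singular m) :
  (forall y, val (s y) = f y) -> singular_gen f = gen F s.
Proof.
move=> sf; rewrite /singular_gen; case: pselect => [fK|[]]; last first.
  have -> : f = set_val \o s by apply/funext => y; rewrite /= -sf.
  split=> [|y]; last by apply: set_mem; apply: valP.
  move=> y; apply: continuous_comp; first exact: cts_fun.
  exact: initial_continuous.
by congr gen; apply/continuousEP => y; apply: val_inj; rewrite sf.
Qed.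

Lemma bd_singular_gen m (f : simplex m.+1 -> {ptws V -> R}) :
  into_polyhedron f -> singular_bd m (singular_gen f) =
    \sum_(j < m.+2) (-1) ^+ j *: singular_gen (f \o simplex_map (lift j)).
Proof.
move=> fK; rewrite (singular_genE (s := singular_of fK)) // free_ext_gen.
apply: eq_bigr => j _; congr (_ *: _).
by rewrite (singular_genE (s := singular_face j (singular_of fK))).
Qed.

Section Push.
Variable P : lmodType R.
Implicit Types (h : P -> {ptws V -> R}) (c : {free F[seq P]}).

Definition push_list m h (s : seq P) : {free F[singular m]} :=
  if size s == m.+1 then singular_gen (h \o @comb R P m s) else 0.

Definition push_chain m h : {free F[seq P]} -> {free F[singular m]} :=
  lin_ext (push_list m h).
HB.instance Definition _ m h := GRing.Linear.on (push_chain m h).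

Lemma push_gen m h s : size s = m.+1 ->
  push_chain m h (gen F s) = singular_gen (h \o @comb R P m s).
Proof. by move=> sm; rewrite /push_chain lin_ext_gen /push_list sm eqxx. Qed.

Definition pushable m h (s : seq P) : Prop :=
  size s = m.+1 /\ into_polyhedron (h \o @comb R P m s).

Lemma bd_push m h c : supported (pushable m.+1 h) c ->
  singular_bd m (push_chain m.+1 h c) = push_chain m h (bd c).
Proof.
rewrite -[LHS]/((singular_bd m \o push_chain m.+1 h) c) -[RHS]/((push_chain m h \o bd) c).
apply: linear_eq_supported => s [sm hK] /=; rewrite push_gen // bd_singular_gen //.
rewrite bd_gen list_boundaryE linear_sum sm; apply: eq_bigr => j _.
rewrite linearZ /= push_gen ?size_del ?sm //; congr (_ *: singular_gen _).
by apply/funext => y; rewrite /= comb_face.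
Qed.

Lemma eq_push m h h' c :
  supported (fun s => forall y, h (@comb R P m s y) = h' (comb s y)) c ->
  push_chain m h c = push_chain m h' c.
Proof.
move=> hh'; apply: eq_lin_ext_in => s /hh' e; rewrite /push_list; case: ifP => // _.
by congr singular_gen; apply/funext.
Qed.

End Push.

Lemma push_lmap_affine (P Q : lmodType R) (A : P -> Q) m (h : Q -> {ptws V -> R}) c :
  (forall (s : seq P) (y : simplex m), size s = m.+1 ->
     comb (map A s) y = A (comb s y)) ->
  push_chain m h (lmap A c) = push_chain m (h \o A) c.
Proof.
move=> Aaff; rewrite -[LHS]/((push_chain m h \o lmap A) c).
apply: linear_eq_gen => s /=; rewrite lmap_gen /push_chain !lin_ext_gen /push_list size_map.
case: eqP => // sm; congr singular_gen; apply/funext => y /=.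
by rewrite Aaff.
Qed.

Lemma push_lmap (P Q : lmodType R) (A : {linear P -> Q}) m (h : Q -> {ptws V -> R}) c :
  push_chain m h (lmap A c) = push_chain m (h \o A) c.
Proof. by apply: push_lmap_affine => s y; apply: comb_map. Qed.

Definition vertices m : seq ('I_m.+1 -> R^o) := map (vertex R) (enum 'I_m.+1).

Lemma size_vertices m : size (vertices m) = m.+1.
Proof. by rewrite size_map size_enum_ord. Qed.

Lemma nth_vertices m (i : 'I_m.+1) : (vertices m)`_i = vertex R i.
Proof. by rewrite (nth_map i) ?size_enum_ord // nth_ord_enum. Qed.

Lemma comb_vertices m (y : simplex m) : comb (vertices m) y = val y.
Proof.
apply/funext => u; rewrite combE (bigD1 u) //= nth_vertices /vertex eqxx mulr1.
rewrite big1 ?addr0 // => i iu; rewrite nth_vertices /vertex.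
by rewrite eq_sym (negPf iu) mulr0.
Qed.

Lemma vertices_full_simplex m : {in vertices m, forall x, full_simplex R 'I_m.+1 x}.
Proof. by move=> _ /mapP[i _ ->]; apply: vertex_full_simplex. Qed.

(** A total function on the ambient vector space, as [push_chain] requires; the value 0 off the
    simplex is never reached from lists of points of the simplex. *)
Definition extension m (s : singular m) (x : 'I_m.+1 -> R^o) : {ptws V -> R} :=
  if pselect (full_simplex R _ x) is left xD then val (s (exist _ x (mem_set xD)))
  else 0.

Lemma extensionE m (s : singular m) x (y : simplex m) :
  x = val y -> extension s x = val (s y).
Proof.
move=> xy; rewrite /extension; case: pselect => [xD|[]].
  by congr (val (s _)); apply: val_inj.
by rewrite xy; apply: full_simplexP.
Qed.

(** Every singular simplex is the image of the universal list [vertices m], so an operator on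
    singular chains is determined by its value on that list. *)
Lemma push_extension m (s : singular m) :
  push_chain m (extension s) (gen F (vertices m)) = gen F s.
Proof.
rewrite push_gen ?size_vertices //; apply: singular_genE => y /=.
by rewrite comb_vertices (extensionE s (y := y)).
Qed.

Lemma comb_simplex m k (l : seq ('I_m.+1 -> R^o)) :
  size l = k.+1 -> {in l, forall x, full_simplex R _ x} ->
  {t : continuousType (simplex k) (simplex m) |
    forall y, val (t y) = comb l y}.
Proof.
move=> lk lD; pose t (y : simplex k) : simplex m :=
  exist _ (comb l y : {ptws 'I_m.+1 -> R}) (mem_set (comb_full_simplex y lk lD)).
have t_cont : continuous t.
  by apply: continuous_comp_initial; apply: comb_continuous.
pose tc : continuousType (simplex k) (simplex m) :=
  HB.pack t (@isContinuous.Build _ _ t t_cont).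
by exists tc.
Qed.

Lemma pushable_extension m (s : singular m) k (l : seq ('I_m.+1 -> R^o)) :
  size l = k.+1 -> {in l, forall x, full_simplex R _ x} -> pushable k (extension s) l.
Proof.
move=> lk lD; split=> //; have [t tE] := comb_simplex lk lD.
have -> : extension s \o @comb R _ k l = set_val \o s \o t.
  by apply/funext => y /=; rewrite (extensionE s (esym (tE y))).
split=> [y|y]; last by apply: set_mem; apply: valP.
apply: continuous_comp; first exact: cts_fun.
by apply: continuous_comp; [exact: cts_fun | exact: initial_continuous].
Qed.

Lemma pushforward_lift m (j : 'I_m.+2) (x : 'I_m.+1 -> R^o) k :
  pushforward (lift j) x (lift j k) = x k.
Proof.
rewrite /pushforward /Defs.push (eq_bigl (pred1 k)) ?big_pred1_eq // => i.
by rewrite (inj_eq lift_inj).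
Qed.

Lemma pushforward_lift_full_simplex m (j : 'I_m.+2) (x : 'I_m.+1 -> R^o) :
  full_simplex R 'I_m.+2 (pushforward (lift j) x) <-> full_simplex R 'I_m.+1 x.
Proof.
split=> [[x0 x1]|]; last exact: push_full_simplex.
split=> [k|]; first by rewrite -(pushforward_lift j x k).
by rewrite -x1 /pushforward /Defs.push (partition_big (lift j) xpredT).
Qed.

Lemma del_vertices m (j : 'I_m.+2) :
  del j (vertices m.+1) = map (pushforward (lift j)) (vertices m).
Proof.
have jv : (j < size (vertices m.+1))%N by rewrite size_vertices.
apply: (@eq_from_nth _ 0); first by rewrite size_del // size_vertices size_map size_vertices.
move=> i; rewrite size_del // size_vertices => im.
rewrite nth_del // [RHS](nth_map 0) ?size_vertices //.
rewrite [X in pushforward _ X](nth_vertices (Ordinal im)) pushforward_vertex.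
exact: (nth_vertices (lift j (Ordinal im))).
Qed.

Lemma extension_lift m (s : singular m.+1) (j : 'I_m.+2) x :
  extension s (pushforward (lift j) x) = extension (singular_face j s) x.
Proof.
rewrite /extension; case: pselect => [xD|xD]; case: pselect => [xD'|xD'] //.
- by congr (val (s _)); apply: val_inj.
- by case: xD'; exact: (pushforward_lift_full_simplex j x).1.
- by case: xD; exact: (pushforward_lift_full_simplex j x).2.
Qed.

Section NaturalOperator.
Variables (M : lmodType F).
Variable op : forall m, singular m -> {linear {free F[seq ('I_m.+1 -> R^o)]} -> M}.
Hypothesis op_natural : forall m (s : singular m.+1) (j : 'I_m.+2) c,
  op s (lmap (pushforward (lift j)) c) = op (singular_face j s) c.

(** The method of universal examples: the [j]-th face of the vertex list is the image of the smaller
    vertex list under the [j]-th face inclusion, and naturality moves this inclusion into the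
    singular simplex. *)
Lemma natural_operator_bd m (z : {free F[singular m.+1]}) :
  lin_ext (fun s => op s (gen F (vertices m))) (singular_bd m z) =
  lin_ext (fun s => op s (bd (gen F (vertices m.+1)))) z.
Proof.
rewrite -[LHS]/((lin_ext (fun s => op s (gen F (vertices m))) \o singular_bd m) z).
apply: linear_eq_gen => s; rewrite /= free_ext_gen lin_ext_gen.
rewrite bd_gen list_boundaryE /singular_boundary !linear_sum size_vertices.
apply: eq_bigr => j _; rewrite [LHS]linearZ [RHS]linearZ /= lin_ext_gen; congr (_ *: _).
by rewrite -op_natural lmap_gen del_vertices.
Qed.

(** Kills the boundary term of a homotopy formula on cycles. In degree 0 every chain is a cycle, but
    the list boundary of a point is the empty list, which [op] must therefore kill. *)
Lemma natural_operator_cycle m (z : {free F[singular m]}) :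
  (forall s : singular 0, op s (gen F [::]) = 0) ->
  is_cycle (C := singular_chain_complex R F polyhedron) z ->
  lin_ext (fun s => op s (bd (gen F (vertices m)))) z = 0.
Proof.
case: m z => [|m] z op0 /= zC; last first.
  by rewrite -natural_operator_bd (eqP zC) linear0.
pose psi : {linear {free F[singular 0]} -> M} := \0.
rewrite -[RHS]/(psi z); apply: linear_eq_gen => s.
rewrite /= lin_ext_gen bd_gen -(op0 s); congr (op s _).
by rewrite /vertices enum_ordSl enum_ord0 /= linear0 subr0.
Qed.

End NaturalOperator.

End SingularPush.

(** * Uniform continuity on a simplex *)

(** The simplex is viewed in row vectors because closed bounded sets are compact there. *)
Lemma matrix_simplex_compact (R : realType) n :
  compact [set M : 'rV[R]_n.+1 | full_simplex R 'I_n.+1 (M ord0)]%classic.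
Proof.
have coord_cont i : continuous (fun M : 'rV[R]_n.+1 => M ord0 i).
  exact: coord_continuous.
apply: bounded_closed_compact.
  exists 1; split; first exact: num_real.
  move=> x x1 M [M0 M1]; apply: le_trans (ltW x1).
  rewrite [leLHS]mx_normrE; apply: bigmax_le => // -[i j] _ /=.
  rewrite [i]ord1 ger0_norm // -M1 (bigD1 j) //= lerDl.
  by apply: sumr_ge0.
have -> : [set M : 'rV[R]_n.+1 | full_simplex R 'I_n.+1 (M ord0)]%classic =
    ((\bigcap_i ((fun M : 'rV[R]_n.+1 => M ord0 i) @^-1` [set x | 0 <= x])) `&`
    ((fun M : 'rV[R]_n.+1 => \sum_i M ord0 i) @^-1` [set x | x = 1]))%classic.
  apply/seteqP; split=> [M [M0 M1]|M [M0 M1]]; split=> // i; first by move=> _; apply: M0.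
  by apply: M0.
apply: closedI.
  by apply: closed_bigI => i _; apply: preimage_closed => // M _; apply: coord_cont.
apply: preimage_closed => // M _.
by apply: (@continuous_big _ _ +%R 0 _ (@add_continuous R)) => i _; apply: coord_cont.
Qed.

(** Uniform continuity, stated for all small [d] so that finitely many functions share one [d]. *)
Lemma full_simplex_uniform (R : realType) n (f : full_simplex R 'I_n.+1 -> R) (e : R) :
  continuous f -> 0 < e ->
  (\forall d \near (0 : R)^'+, forall p q : full_simplex R 'I_n.+1,
    (forall i, `|(val p : {ptws 'I_n.+1 -> R}) i - (val q : {ptws 'I_n.+1 -> R}) i| < d) ->
    `|f p - f q| < e)%classic.
Proof.
move=> fc e0.
(* [bad d M] is the wanted estimate itself, restricted to the point [p] with coordinates [M]. *)
pose bad (d : R) (M : 'rV[R]_n.+1) := forall p q : full_simplex R 'I_n.+1,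
  val p = M ord0 :> ('I_n.+1 -> R) ->
  (forall i, `|(val p : {ptws 'I_n.+1 -> R}) i - (val q : {ptws 'I_n.+1 -> R}) i| < d) ->
    `|f p - f q| < e.
pose mx (p : full_simplex R 'I_n.+1) : 'rV[R]_n.+1 :=
  \row_i (val p : {ptws 'I_n.+1 -> R}) i.
have mxE p : mx p ord0 = val p :> ('I_n.+1 -> R) by apply/funext => i; rewrite mxE.
(* Compactness in its near-covering form: estimates near each point, valid for all small [d],
   combine into a single one. *)
have := @matrix_simplex_compact R n.
move=> /compact_near_coveringP/near_covering_withinP/(_ _ (0 : R)^'+%classic bad _) cover.
pose D : set 'rV[R]_n.+1 := [set M : 'rV[R]_n.+1 | full_simplex R 'I_n.+1 (M ord0)]%classic.
have near_bad : forall M : 'rV[R]_n.+1, D M ->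
  (\forall M' \near M & d \near (0 : R)^'+, D M' -> bad d M')%classic.
  move=> M MD.
  pose p0 : full_simplex R 'I_n.+1 := exist _ (M ord0 : {ptws 'I_n.+1 -> R}) (mem_set MD).
  have [W [Wo Wp0] Wf] : exists2 W : set {ptws 'I_n.+1 -> R},
      (open W /\ W (M ord0)) &
      forall q : full_simplex R 'I_n.+1, W (val q) -> `|f p0 - f q| < e / 2.
    have : nbhs p0 [set q | `|f p0 - f q| < e / 2]%classic.
      have /cvgrPdist_lt /(_ (e / 2)) := fc p0; apply.
      by rewrite divr_gt0.
    rewrite nbhsE => -[U [[W Wo WU] Up0] Uf]; exists W; last first.
      by move=> q Wq; apply: Uf; rewrite -WU.
    by split=> //; move: Up0; rewrite -WU.
  have [r r0 rW] : exists2 r : R, 0 < r &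
      forall M' : 'rV[R]_n.+1, ball M r M' -> W (M' ord0).
    have row_cont : continuous (fun M' : 'rV[R]_n.+1 => (M' ord0 : {ptws 'I_n.+1 -> R})).
      by apply: continuous_ptws => i; apply: coord_continuous.
    have /nbhs_ballP[r /= r0 rW] := row_cont M W (open_nbhs_nbhs (conj Wo Wp0)).
    by exists r => // M' /rW.
  (* The point [p] is within [r / 2] of [M] and [q] within [r / 2] of [p]; both thus fall in the
     ball where [f] differs from [f p0] by less than [e / 2]. *)
  have r2 : 0 < r / 2 by rewrite divr_gt0.
  exists ([set M' | ball M (r / 2) M'], [set d : R | d < r / 2])%classic => /=.
    split; first exact: nbhsx_ballx.
    exact: nbhs_right_lt.
  move=> [M' d] /= [MM' dr] _ p q pM' pq.
  have fp0 (q' : full_simplex R 'I_n.+1) :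
      (forall i, `|(val q' : {ptws 'I_n.+1 -> R}) i - M' ord0 i| < r / 2) ->
      `|f p0 - f q'| < e / 2.
    move=> q'M'; apply: Wf; rewrite -(mxE q'); apply: rW.
    rewrite (splitr r); apply: ball_triangle MM' _.
    split=> // i j; rewrite [i]ord1 mxE -ball_normE /= distrC; exact: q'M'.
  rewrite (splitr e); apply: le_lt_trans (ler_distD (f p0) _ _) _.
  rewrite ltrD //; first rewrite distrC; apply: fp0 => i.
    by rewrite -pM' subrr normr0.
  by rewrite -pM' distrC; apply: lt_trans dr.
apply: filterS (cover near_bad) => d dD p q pq.
by apply: (dD (mx p)) => //=; rewrite ?mxE //; apply: full_simplexP.
Qed.

(** * Subdivision of singular chains *)

Section SingularSubdivision.
Variables (R : realType) (F : fieldType) (V : finType) (K : simplicial_complex V).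

Local Notation polyhedron := (classical_sets.set_type (@realization R V K)).
Local Notation simplex m := (full_simplex R 'I_m.+1).
Local Notation singular m := (continuousType (simplex m) polyhedron).
Local Notation singular_bd m := (free_ext (@singular_boundary R F polyhedron m)).
Local Notation is_singular_cycle z :=
  (is_cycle (C := singular_chain_complex R F polyhedron) z).

Definition subdivide k m : {free F[singular m]} -> {free F[singular m]} :=
  lin_ext (fun s : singular m =>
    push_chain K m (extension s) (sd_iter k (gen F (vertices R m)))).
HB.instance Definition _ k m := GRing.Linear.on (@subdivide k m).

Lemma supported_sd_iter_vertices k m :
  supported (fun l => [/\ size l = m.+1, {in l, forall x, full_simplex R 'I_m.+1 x}
      & forall i : 'I_m.+1, spread (linear_coord i) ((m%:R / m.+1%:R) ^+ k) l])
    (sd_iter k (gen F (vertices R m))).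
Proof.
apply: (sub_supported _ (@supported_sd_iter F _ _ m k (vertices R m))).
move=> l [sl hull_l spread_l]; rewrite size_vertices in sl spread_l.
split=> // [|i].
  apply: hull_l; first exact: full_simplex_barycenter_closed.
  exact: vertices_full_simplex.
(* A coordinate takes only the values 0 and 1 on the vertices, so the initial spread is 1. *)
rewrite -[_ ^+ k]mulr1; apply: spread_l => // _ _ /mapP[j _ ->] /mapP[j' _ ->].
rewrite /linear_coord /vertex.
by apply: (@le_trans _ _ (i == j)%:R); rewrite ?gerBl ?ler0n // lern1 leq_b1.
Qed.

Lemma pushable_sd_iter k m (s : singular m) :
  supported (pushable K m (extension s)) (sd_iter k (gen F (vertices R m))).
Proof.
apply: (sub_supported _ (@supported_sd_iter_vertices k m)) => l [sl lD _].
exact: pushable_extension.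
Qed.

Lemma push_chain_lift m n (s : singular m.+1) (j : 'I_m.+2)
    (c : {free F[seq ('I_m.+1 -> R^o)]}) :
  push_chain K n (extension s) (lmap (pushforward (lift j)) c) =
  push_chain K n (extension (singular_face j s)) c.
Proof.
by rewrite push_lmap; apply: eq_push => l _ y; apply: extension_lift.
Qed.

Lemma bd_subdivide k m (z : {free F[singular m.+1]}) :
  singular_bd m (subdivide k z) = subdivide k (singular_bd m z).
Proof.
pose op n (s : singular n) : {linear {free F[seq ('I_n.+1 -> R^o)]} -> {free F[singular m]}} :=
  push_chain K m (extension s) \o sd_iter k.
rewrite [RHS](@natural_operator_bd _ _ _ _ _ op) => [|n s j c]; last first.
  by rewrite /op /= sd_iter_natural push_chain_lift.
rewrite -[LHS]/((singular_bd m \o @subdivide k m.+1) z).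
apply: linear_eq_gen => s; rewrite /= /subdivide !lin_ext_gen /op /=.
by rewrite bd_push ?bd_sd_iter //; apply: pushable_sd_iter.
Qed.

Lemma subdivide_homologous k m (z : {free F[singular m]}) : is_singular_cycle z ->
  exists w, singular_bd m w = z - subdivide k z.
Proof.
move=> zC.
pose op n (s : singular n) : {linear {free F[seq ('I_n.+1 -> R^o)]} -> {free F[singular m]}} :=
  push_chain K m (extension s) \o sd_homotopy k.
pose T : {linear {free F[singular m]} -> {free F[singular m.+1]}} :=
  lin_ext (fun s : singular m =>
    push_chain K m.+1 (extension s) (sd_homotopy k (gen F (vertices R m)))).
exists (T z).
have op_natural n (s : singular n.+1) (j : 'I_n.+2) c :
    op n.+1 s (lmap (pushforward (lift j)) c) = op n (singular_face j s) c.
  by rewrite /op /= sd_homotopy_natural push_chain_lift.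
have op_nil (s : singular 0) : op 0 s (gen F [::]) = 0.
  by rewrite /op /= sd_homotopy_nil linear0.
have op_z := natural_operator_cycle op_natural op_nil zC.
(* The homotopy formula holds simplex by simplex only with its boundary term [E], which vanishes on
   the cycle [z] but not on single simplices; [psi] keeps it so that generators suffice. *)
pose E : {linear {free F[singular m]} -> {free F[singular m]}} :=
  lin_ext (fun s : singular m => op m s (bd (gen F (vertices R m)))).
pose psi : {linear {free F[singular m]} -> {free F[singular m]}} :=
  (idfun \- @subdivide k m) \- E.
have -> : z - subdivide k z = psi z by rewrite /= op_z subr0.
rewrite -[LHS]/((singular_bd m \o T) z); apply: linear_eq_gen => s.
rewrite /= /subdivide !lin_ext_gen bd_push.
  by rewrite bd_sd_homotopy !linearB /= push_extension.
apply: (sub_supported _ (@supported_sd_homotopy F _ _ k (vertices R m))) => l [sl hull_l].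
apply: pushable_extension; first by rewrite sl size_vertices.
apply: hull_l; first exact: full_simplex_barycenter_closed.
exact: vertices_full_simplex.
Qed.

End SingularSubdivision.

(** * Small singular simplices *)

Section Label.
Variables (R : realType) (V : finType) (v0 : V).

(** A point of a simplex lies in the open star of its label. *)
Definition label (x : V -> R^o) : V := [arg max_(v > v0) (x v : R)]%O.

(** The largest coordinate is at least the mean, and the coordinates sum to 1. *)
Lemma label_ge (x : V -> R^o) : full_simplex R V x ->
  #|V|%:R^-1 <= x (label x).
Proof.
move=> [x0 x1]; rewrite /label; case: Order.TotalTheory.arg_maxP => //= v _ vmax.
have V0 : 0 < #|V|%:R :> R by rewrite ltr0n; apply/card_gt0P; exists v0.
rewrite -[_^-1]mul1r ler_pdivrMr // -[X in X <= _]x1 mulr_natr -sumr_const.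
by apply: ler_sum => w _; apply: vmax.
Qed.

Lemma label_neq0 (x : V -> R^o) : full_simplex R V x -> x (label x) != 0.
Proof.
move=> /label_ge xl; rewrite gt_eqF //; apply: lt_le_trans xl.
by rewrite invr_gt0 ltr0n; apply/card_gt0P; exists v0.
Qed.

End Label.

Section SmallSimplices.
Variables (R : realType) (F : fieldType) (V : finType) (K : simplicial_complex V).
Variable v0 : V.

Local Notation polyhedron := (classical_sets.set_type (@realization R V K)).
Local Notation simplex m := (full_simplex R 'I_m.+1).
Local Notation singular m := (continuousType (simplex m) polyhedron).

Definition vertex_label m (s : singular m) (i : 'I_m.+1) : V :=
  label v0 (extension s (vertex R i)).

Definition small m (s : singular m) : Prop :=
  forall i y, (val (s y) : {ptws V -> R}) (vertex_label s i) != 0.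

Lemma singular_full_simplex m (s : singular m) y : full_simplex R V (val (s y)).
Proof. by have /set_mem[] := valP (s y). Qed.

Lemma extension_vertex m (s : singular m) i :
  {y | extension s (vertex R i) = val (s y)}.
Proof.
exists (exist _ (vertex R i : {ptws _ -> R}) (mem_set (vertex_full_simplex R i))).
exact: extensionE.
Qed.

Lemma singular_coord_continuous m (s : singular m) v :
  continuous (fun y => (val (s y) : {ptws V -> R}) v).
Proof.
move=> y; apply: (@continuous_comp _ _ _ s
  (fun p : polyhedron => (val p : {ptws V -> R}) v)); first exact: cts_fun.
exact: (continuous_comp (@initial_continuous _ _ set_val (s y))
  (@proj_continuous _ _ v _)).
Qed.

(** The threshold is the lower bound in [label_ge]: a coordinate that large cannot vanish after a
    smaller change. It plays the part of a Lebesgue number for the cover by open stars. *)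
Lemma singular_uniform m (s : singular m) :
  exists2 d : R, 0 < d & forall (p q : simplex m) v,
    (forall i, `|(val p : {ptws 'I_m.+1 -> R}) i - (val q : {ptws 'I_m.+1 -> R}) i| < d) ->
    `|(val (s p) : {ptws V -> R}) v - (val (s q) : {ptws V -> R}) v| < #|V|%:R^-1.
Proof.
have V0 : 0 < #|V|%:R^-1 :> R by rewrite invr_gt0 ltr0n; apply/card_gt0P; exists v0.
have near_s : (\forall d \near (0 : R)^'+, forall v (p q : simplex m),
    (forall i, `|(val p : {ptws 'I_m.+1 -> R}) i - (val q : {ptws 'I_m.+1 -> R}) i| < d) ->
    `|(val (s p) : {ptws V -> R}) v - (val (s q) : {ptws V -> R}) v| < #|V|%:R^-1)%classic.
  apply: filter_forall => v; apply: full_simplex_uniform => //.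
  exact: singular_coord_continuous.
have near_pos : (\forall d \near (0 : R)^'+, 0 < d)%classic by exact: nbhs_right_gt.
have [d [d0 dP]] := filter_ex (filterI near_pos near_s).
by exists d => // p q v; apply: dP.
Qed.

(** Smallness holds for every later [k], so a maximum serves all simplices of a chain. *)
Lemma subdivide_gen_small m (s : singular m) :
  exists k0, forall k, (k0 <= k)%N -> supported (@small m) (subdivide k (gen F s)).
Proof.
have [d d0 d_unif] := singular_uniform s.
have rho_lt1 : `|m%:R / m.+1%:R : R| < 1.
  by rewrite ger0_norm ?divr_ge0 ?ler0n // ltr_pdivrMr ?ltr0n // mul1r ltr_nat.
have [k0 _ k0P] : (\forall k \near \oo, (m%:R / m.+1%:R : R) ^+ k < d)%classic.
  have := cvg_expr rho_lt1 => /cvgrPdist_lt /(_ d d0); apply: filterS => k.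
  by rewrite sub0r normrN ger0_norm // exprn_ge0 // divr_ge0 ?ler0n.
exists k0 => k k0k; rewrite /subdivide lin_ext_gen.
apply: supported_lin_ext (@supported_sd_iter_vertices R F k m) => l [sl lD spread_l].
rewrite /push_list sl eqxx; have [t tE] := comb_simplex sl lD.
have sE y : extension s (comb l y) = val (s (t y)).
  by apply: extensionE; rewrite tE.
have [_ lK] := pushable_extension s sl lD.
rewrite (singular_genE F (s := singular_of lK)) //.
apply: supported_gen => i y; have [y' y'E] := extension_vertex (singular_of lK) i.
rewrite /vertex_label y'E [val (_ y')]sE [val (_ y)]sE.
set v := label _ _.
have v_ge : #|V|%:R^-1 <= (val (s (t y')) : {ptws V -> R}) v.
  exact/label_ge/singular_full_simplex.
rewrite gt_eqF //.
have ty_close j : `|(val (t y') : {ptws 'I_m.+1 -> R}) j - (val (t y) : {ptws 'I_m.+1 -> R}) j| < d.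
  apply: le_lt_trans (k0P k k0k); rewrite !tE ler_norml.
  rewrite lerNl opprB.
  by apply/andP; split; apply: (comb_spread (phi := linear_coord j)).
(* At the vertex [y'] the coordinate of its label [v] is at least [1 / #|V|], and it varies by less
   than that. *)
by move: (d_unif _ _ v ty_close) => /ltr_normlW; lra.
Qed.

Lemma subdivide_small m (z : {free F[singular m]}) :
  exists k, supported (@small m) (subdivide k z).
Proof.
suff [k kP] : exists k, forall s, s \in monalg.msupp z ->
    supported (@small m) (subdivide k (gen F s)).
  exists k; rewrite -[z]free_ext_id linear_free_ext.
  by apply: (supported_ext (A := fun s => s \in monalg.msupp z)).
suff [k kP] : exists k0, forall k, (k0 <= k)%N -> {in (monalg.msupp z : seq _), forall s,
    supported (@small m) (subdivide k (gen F s))}.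
  by exists k => s; apply: kP.
elim: (monalg.msupp z : seq _) => [|s r [k1 k1P]]; first by exists 0%N.
have [k2 k2P] := subdivide_gen_small s; exists (maxn k1 k2) => k.
rewrite geq_max => /andP[kk1 kk2] s'; rewrite inE => /orP[/eqP->|]; first exact: k2P.
exact: k1P.
Qed.

End SmallSimplices.

(** * The prism *)

Section PrismOperator.
Variables (F : fieldType) (R : realType) (P : lmodType R).

Definition at_height (t : R) (x : P) : P * R^o := (x, t).

(** The recursion replaces the explicit triangulation of the prism: it joins the bottom copy to the
    top copy, coning from the first bottom vertex. *)
Definition prism : {free F[seq P]} -> {free F[seq (P * R^o)%type]} :=
  cone_homotopy (lmap (at_height 1) \- lmap (at_height 0))
    (fun s => at_height 0 (head 0 s)).
HB.instance Definition _ := GRing.Linear.on prism.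

Lemma prism_nil : prism (gen F [::]) = 0.
Proof. by apply: cone_homotopy_nil; rewrite /= !lmap_gen subrr. Qed.

Lemma bd_prism c :
  bd (prism c) = lmap (at_height 1) c - lmap (at_height 0) c - prism (bd c).
Proof.
by apply: bd_cone_homotopy => {}c; rewrite /= linearB /= !bd_lmap.
Qed.

Lemma supported_prism s :
  supported (fun l => size l = (size s).+1 /\
      {in l, forall q, q.1 \in s /\ 0 <= (q.2 : R) <= 1})
    (prism (gen F s)).
Proof.
pose A s l := [/\ s != [::], size l = size s &
  {in l, forall q : P * R^o, q.1 \in s /\ 0 <= (q.2 : R) <= 1}].
move: s; apply: (supported_cone_homotopy (A := A)) => [s j l js [szl lP]|s l|s].
- split=> [|q]; first by rewrite /= szl size_del // prednK // (leq_trans _ js).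
  rewrite in_cons => /orP[/eqP->|].
    by rewrite /= lexx ler01; case: (s) js => //= p s' _; rewrite mem_head.
  by move=> /lP[/(mem_subseq (subseq_del _ _))].
- move=> [s0 szl lP]; split=> [|q]; first by rewrite /= szl.
  rewrite in_cons => /orP[/eqP->|]; last exact: lP.
  by rewrite /= lexx ler01; case: (s) s0 => //= p s' _; rewrite mem_head.
case: (eqVneq s [::]) => [->|s0].
  by rewrite /= !lmap_gen subrr; apply: supported0.
rewrite /= !lmap_gen; apply: supportedB; apply: supported_gen; split=> //;
  rewrite ?size_map // => _ /mapP[p ps ->] /=; by rewrite ?lexx ?ler01.
Qed.

End PrismOperator.

Section PrismNatural.
Variables (F : fieldType) (R : realType) (P P' : lmodType R) (A : {linear P -> P'}).

Definition prism_map (q : P * R^o) : P' * R^o := (A q.1, q.2).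

Lemma prism_map_is_linear : linear prism_map.
Proof. by move=> a x y; rewrite /prism_map /= linearP. Qed.

HB.instance Definition _ := GRing.isLinear.Build R (P * R^o)%type (P' * R^o)%type _
  prism_map prism_map_is_linear.

Lemma prism_natural (c : {free F[seq P]}) :
  prism (lmap A c) = lmap prism_map (prism c).
Proof.
apply: cone_homotopy_natural => [{}c|s s0|] /=.
- by rewrite linearB /= !lmap_comp.
- by case: s s0.
by rewrite !lmap_gen subrr.
Qed.

End PrismNatural.

Section CombAtHeight.
Variables (R : realType) (P : lmodType R).

Lemma comb_fst m (l : seq (P * R^o)) (y : full_simplex R 'I_m.+1) :
  size l = m.+1 -> (comb l y).1 = comb (map fst l) y.
Proof. by move=> lm; rewrite (comb_map _ _ lm). Qed.

(** The map [at_height t] is affine but not linear; its second component comes out right because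
    barycentric coordinates sum to 1. *)
Lemma comb_at_height (t : R) m (s : seq P) (y : full_simplex R 'I_m.+1) :
  size s = m.+1 -> comb (map (at_height t) s) y = at_height t (comb s y).
Proof.
move=> sm; apply: injective_projections => /=.
  by rewrite comb_fst ?size_map // -map_comp map_id.
have [_ y1] := full_simplexP y.
rewrite -(comb_map snd) ?size_map // -map_comp /comb -[RHS]mul1r -y1 mulr_suml.
by apply: eq_bigr => i _; rewrite (nth_map 0) ?sm.
Qed.

End CombAtHeight.

(** * Realization of ordered chains *)

Section Realization.
Variables (R : realType) (V : finType) (K : simplicial_complex V).

Lemma realization_sub (x : V -> R^o) (t : {set V}) : t \in K ->
  full_simplex R V x -> (forall v, x v != 0 -> v \in t) -> realization K x.
Proof.
move=> tK xD xt; split=> //; apply: (simplex_face tK).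
  by apply/fintype.subsetP => v; rewrite inE => /xt.
apply/set0Pn; have [_ x1] := xD.
have [[v xv]|x0] := pselect (exists v, x v != 0); first by exists v; rewrite inE.
have := oner_neq0 R; rewrite -x1 big1 ?eqxx // => v _.
by apply/eqP; apply: contra_notT x0 => xv; exists v.
Qed.

Lemma full_simplex_segment (a b : V -> R^o) (t : R) : 0 <= t <= 1 ->
  full_simplex R V a -> full_simplex R V b ->
  full_simplex R V (fun v => (1 - t) * a v + t * b v).
Proof.
move=> /andP[t0 t1] [a0 a1] [b0 b1]; split=> [v|].
  by rewrite addr_ge0 // mulr_ge0 // subr_ge0.
by rewrite big_split /= -!mulr_sumr a1 b1 !mulr1 subrK.
Qed.

End Realization.

Lemma continuous_segment (R : realType) (T : topologicalType) (h a b : T -> R) :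
  continuous h -> continuous a -> continuous b ->
  continuous (fun y => (1 - h y) * a y + h y * b y).
Proof.
move=> h_cont a_cont b_cont y.
have h1 : {for y, continuous (cst 1 - h)}.
  by apply: continuousB; [exact: cst_continuous | exact: h_cont].
exact: (continuousD (continuousM h1 (a_cont y)) (continuousM (h_cont y) (b_cont y))).
Qed.

Section OrderedChains.
Variables (R : realType) (F : fieldType) (V : finType) (K : simplicial_complex V).

Local Notation polyhedron := (classical_sets.set_type (@realization R V K)).
Local Notation simplex m := (full_simplex R 'I_m.+1).
Local Notation singular m := (continuousType (simplex m) polyhedron).
Local Notation singular_bd m := (free_ext (@singular_boundary R F polyhedron m)).
Local Notation is_singular_cycle z :=
  (is_cycle (C := singular_chain_complex R F polyhedron) z).

Definition ordered_simplex n (l : seq V) : Prop :=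
  size l = n /\ exists2 t, t \in K & {subset l <= t}.

Definition realize m : {free F[seq V]} -> {free F[singular m]} :=
  push_chain K m (fun x : V -> R^o => x) \o lmap (vertex R).
HB.instance Definition _ m := GRing.Linear.on (realize m).

Lemma pushable_vertices m (l : seq V) : ordered_simplex m.+1 l ->
  pushable K m (fun x : V -> R^o => x) (map (vertex R) l).
Proof.
move=> [sl [t tK lt]]; split; first by rewrite size_map.
split=> [y|y]; first exact: comb_continuous.
have sm : size (map (vertex R) l) = m.+1 by rewrite size_map.
apply: (realization_sub tK).
  by apply: comb_full_simplex => // _ /mapP[v _ ->]; apply: vertex_full_simplex.
move=> v; apply: contraNT => vt; apply/eqP; rewrite /= combE big1 // => i _.
rewrite (nth_map v) ?sl // /vertex; case: eqP => [vl|_]; last by rewrite mulr0.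
by move: vt; rewrite vl lt // mem_nth ?sl.
Qed.

Lemma bd_realize m c : supported (ordered_simplex m.+2) c ->
  singular_bd m (realize m.+1 c) = realize m (bd c).
Proof.
move=> cK; rewrite /realize /= bd_push ?bd_lmap //.
by apply: (supported_lmap (A := ordered_simplex m.+2)) => // l /pushable_vertices.
Qed.

Variable v0 : V.

Local Notation vertex_label := (vertex_label v0).
Local Notation small := (small v0).

Definition label_chain m : {free F[singular m]} -> {free F[seq V]} :=
  lin_ext (fun s : singular m => gen F (map (vertex_label s) (enum 'I_m.+1))).
HB.instance Definition _ m := GRing.Linear.on (@label_chain m).

Lemma vertex_label_lift m (s : singular m.+1) (j : 'I_m.+2) i :
  vertex_label s (lift j i) = vertex_label (singular_face j s) i.
Proof. by rewrite /vertex_label -pushforward_vertex extension_lift. Qed.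

Lemma label_chain_gen m (s : singular m) :
  label_chain (gen F s) = lmap (label v0 \o extension s) (gen F (vertices R m)).
Proof. by rewrite /label_chain lin_ext_gen lmap_gen; congr gen; rewrite -[RHS]map_comp. Qed.

Lemma supported_label_chain m (z : {free F[singular m]}) :
  supported (@small m) z -> supported (ordered_simplex m.+1) (label_chain z).
Proof.
apply: supported_lin_ext => s s_small; apply: supported_gen; split.
  by rewrite size_map size_enum_ord.
(* Any point will do: by smallness its carrier, a simplex of [K], contains all the labels. *)
have [y _] := extension_vertex s ord0.
have /set_mem[_ yK] := valP (s y); exists (carrier (val (s y))) => // v.
by move=> /mapP[i _ ->]; rewrite inE; apply: s_small.
Qed.

Section LabelOperator.
Variables (M : lmodType F) (g : {linear {free F[seq V]} -> M}).

Let op n (s : singular n) : {linear {free F[seq ('I_n.+1 -> R^o)]} -> M} :=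
  g \o lmap (label v0 \o extension s).

Let op_natural n (s : singular n.+1) (j : 'I_n.+2) c :
  op s (lmap (pushforward (lift j)) c) = op (singular_face j s) c.
Proof.
have op_lift : (label v0 \o extension s) \o pushforward (lift j) =
    label v0 \o extension (singular_face j s).
  by apply/funext => x /=; rewrite extension_lift.
by rewrite /op /= lmap_comp op_lift.
Qed.

Lemma label_chain_operator m (z : {free F[singular m]}) :
  lin_ext (fun s => op s (bd (gen F (vertices R m)))) z = g (bd (label_chain z)).
Proof.
rewrite -[RHS]/((g \o bd \o @label_chain m) z).
apply: linear_eq_gen => s; rewrite /= lin_ext_gen /op /= label_chain_gen.
by rewrite bd_lmap.
Qed.

(** In degree 0 the chain [bd (label_chain z)] is the coefficient sum of [z] times the empty list
    and need not vanish, hence the condition on [g]. *)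
Lemma label_chain_cycle m (z : {free F[singular m]}) :
  g (gen F [::]) = 0 -> is_singular_cycle z -> g (bd (label_chain z)) = 0.
Proof.
move=> g_nil zC; rewrite -label_chain_operator.
apply: natural_operator_cycle => // s.
by rewrite /op /= lmap_gen.
Qed.

Lemma label_chain_bd m (z : {free F[singular m.+1]}) :
  g (bd (label_chain z)) = g (label_chain (singular_bd m z)).
Proof.
rewrite -label_chain_operator -natural_operator_bd //.
rewrite -[RHS]/((g \o @label_chain m) (singular_bd m z)).
apply: linear_eq_gen => s; rewrite /= lin_ext_gen /op /=.
by rewrite label_chain_gen.
Qed.

End LabelOperator.

Lemma bd_label_chain m (z : {free F[singular m.+1]}) :
  bd (label_chain z) = label_chain (singular_bd m z).
Proof. exact: (label_chain_bd idfun). Qed.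

Definition straight_line m (s : singular m) (q : ('I_m.+1 -> R^o) * R^o) :
    {ptws V -> R} :=
  fun v => (1 - q.2) * extension s q.1 v + q.2 * pushforward (vertex_label s) q.1 v.

Lemma straight_line_lift m (s : singular m.+1) (j : 'I_m.+2) q :
  straight_line s (prism_map (pushforward (lift j)) q) =
  straight_line (singular_face j s) q.
Proof.
apply/funext => v; rewrite /straight_line /= extension_lift pushforward_comp.
congr (_ + _ * _); congr (pushforward _ _ _).
by apply/funext => i /=; rewrite vertex_label_lift.
Qed.

(** By smallness the labels are vertices of the carrier of each point of [s], so both ends of each
    segment, and then the segment, lie in one closed simplex of [K]. *)
Lemma pushable_straight_line m (s : singular m) k
    (l : seq (('I_m.+1 -> R^o) * R^o)%type) : small s -> size l = k.+1 ->
  {in l, forall q, full_simplex R 'I_m.+1 q.1 /\ 0 <= (q.2 : R) <= 1} ->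
  pushable K k (straight_line s) l.
Proof.
move=> s_small sl lP; split=> //.
have sl1 : size (map fst l) = k.+1 by rewrite size_map.
have [t tE] : {t : continuousType (simplex k) (simplex m) |
    forall y, val (t y) = comb (map fst l) y}.
  by apply: comb_simplex => // _ /mapP[q ql ->]; case: (lP q ql).
have lineE y : straight_line s (comb l y) = fun v =>
    (1 - (comb l y).2) * (val (s (t y)) : {ptws V -> R}) v +
    (comb l y).2 * comb (map (pushforward (vertex_label s)) (map fst l)) y v.
  apply/funext => v; rewrite /straight_line comb_fst //.
  rewrite (comb_map (pushforward (vertex_label s)) _ sl1).
  by rewrite (extensionE s (esym (tE y))).
have height_cont : continuous (fun y : simplex k => (comb l y).2 : R).
  exact: (@linear_comb_continuous _ _ snd).
have heightP (y : simplex k) : 0 <= ((comb l y).2 : R) <= 1.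
  apply/andP; split.
    by apply: (@comb_ge R _ snd k l y 0 sl) => q /lP[_ /andP[]].
  by apply: (@comb_le R _ snd k l y 1 sl) => q /lP[_ /andP[]].
have -> : straight_line s \o @comb R _ k l = fun y v =>
    (1 - (comb l y).2) * (val (s (t y)) : {ptws V -> R}) v +
    (comb l y).2 * comb (map (pushforward (vertex_label s)) (map fst l)) y v.
  by apply/funext.
split=> y; last first.
  have [aD aK] := set_mem (valP (s (t y))).
  have bD : full_simplex R V (pushforward (vertex_label s) (val (t y))).
    exact/push_full_simplex/full_simplexP.
  apply: (realization_sub aK); rewrite (comb_map (pushforward (vertex_label s)) _ sl1) -tE.
    exact: full_simplex_segment.
  move=> v; rewrite inE; apply: contraNneq => av0.
  have push0 : pushforward (vertex_label s) (val (t y)) v = 0.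
    apply: big1 => i /eqP iv.
    by have := s_small i (t y); rewrite iv av0 eqxx.
  by rewrite av0 mulr0 add0r [X in _ * X]push0 mulr0.
have a_cont v : continuous (fun y => (val (s (t y)) : {ptws V -> R}) v).
  move=> {}y; apply: (@continuous_comp _ _ _ t (fun x => (val (s x) : {ptws V -> R}) v)).
    exact: cts_fun.
  exact: singular_coord_continuous.
have b_cont v : continuous (fun y : simplex k =>
    (comb (map (pushforward (vertex_label s)) (map fst l)) y v : R)).
  exact: (@linear_comb_continuous _ _ (linear_coord v)).
apply: (@continuous_ptws R (simplex k) V) => v {}y.
exact: (continuous_segment height_cont (a_cont v) (b_cont v)).
Qed.

Lemma straight_line_homologous m (z : {free F[singular m]}) :
  is_singular_cycle z -> supported (@small m) z ->
  exists w, singular_bd m w = realize m (label_chain z) - z.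
Proof.
move=> zC z_small.
pose op n (s : singular n) : {linear {free F[seq ('I_n.+1 -> R^o)]} -> {free F[singular m]}} :=
  push_chain K m (straight_line s) \o (@prism F R _).
have op_natural n (s : singular n.+1) (j : 'I_n.+2) c :
    op n.+1 s (lmap (pushforward (lift j)) c) = op n (singular_face j s) c.
  rewrite /op /= prism_natural push_lmap; apply: eq_push => l _ y.
  exact: straight_line_lift.
have op_nil (s : singular 0) : op 0 s (gen F [::]) = 0.
  by rewrite /op /= prism_nil linear0.
have op_z := natural_operator_cycle op_natural op_nil zC.
pose E : {linear {free F[singular m]} -> {free F[singular m]}} :=
  lin_ext (fun s : singular m => op m s (bd (gen F (vertices R m)))).
pose T : {linear {free F[singular m]} -> {free F[singular m.+1]}} :=
  lin_ext (fun s : singular m =>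
    push_chain K m.+1 (straight_line s) (prism (gen F (vertices R m)))).
exists (T z).
pose psi : {linear {free F[singular m]} -> {free F[singular m]}} :=
  ((realize m \o @label_chain m) \- idfun) \- E.
have -> : realize m (label_chain z) - z = psi z by rewrite /= op_z subr0.
rewrite -[LHS]/((singular_bd m \o T) z); apply: linear_eq_supported z_small => s s_small.
have top : push_chain K m (straight_line s) (lmap (at_height 1) (gen F (vertices R m))) =
    realize m (label_chain (gen F s)).
  rewrite push_lmap_affine; last by move=> l y; apply: comb_at_height.
  rewrite /label_chain lin_ext_gen /realize /= lmap_gen.
  have -> : map (vertex R) (map (vertex_label s) (enum 'I_m.+1)) =
      map (pushforward (vertex_label s)) (vertices R m).
    rewrite -[LHS]map_comp -[RHS]map_comp; apply: eq_map => i /=.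
    by rewrite pushforward_vertex.
  rewrite -[in RHS]lmap_gen push_lmap; apply: eq_push => l _ y; apply/funext => v /=.
  by rewrite /straight_line /= subrr mul0r add0r mul1r.
have bottom : push_chain K m (straight_line s) (lmap (at_height 0) (gen F (vertices R m))) =
    gen F s.
  rewrite push_lmap_affine; last by move=> l y; apply: comb_at_height.
  rewrite -[RHS](push_extension F s); apply: eq_push => l _ y; apply/funext => v /=.
  by rewrite /straight_line /= subr0 mul1r mul0r addr0.
rewrite /= !lin_ext_gen bd_push; last first.
  apply: (sub_supported _ (@supported_prism F _ _ (vertices R m))) => l [sl lP].
  apply: pushable_straight_line; rewrite ?sl ?size_vertices //.
  by move=> q /lP[q1 q2]; split=> //; apply: vertices_full_simplex.
rewrite bd_prism [LHS]linearB /= [X in X - _ = _]linearB /= top bottom.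
by [].
Qed.

End OrderedChains.

(** * Simplicial and singular homology *)

Lemma comb_vertex (R : realType) (P : lmodType R) m (l : seq P) (i : 'I_m.+1)
    (y : full_simplex R 'I_m.+1) :
  val y = vertex R i -> comb l y = l`_i.
Proof.
move=> yi; rewrite /comb (bigD1 i) //= yi /vertex eqxx scale1r big1 ?addr0 // => j ji.
by rewrite (negPf ji) scale0r.
Qed.

Section FaceHomotopy.
Variables (F : fieldType) (V : finType) (v0 : V).
Variable g : {linear {free F[seq V]} -> {free F[seq V]}}.

(** Coning from the first vertex adds no new vertex, so the homotopy stays within a simplex whenever
    [g] does. *)
Lemma supported_face_homotopy s :
  g (gen F [::]) = 0 ->
  (forall s, supported (fun t => size t = size s /\ {subset t <= s}) (g (gen F s))) ->
  supported (fun t => size t = (size s).+1 /\ {subset t <= s})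
    (cone_homotopy g (head v0) (gen F s)).
Proof.
move=> g_nil gP.
pose A (s t : seq V) : Prop := [/\ s != [::], size t = size s & {subset t <= s}].
move: s; apply: (supported_cone_homotopy (A := A)) => [s j t js [szt ts]|s t|s].
- split=> [|p]; first by rewrite /= szt size_del // prednK // (leq_trans _ js).
  rewrite in_cons => /orP[/eqP->|/ts/(mem_subseq (subseq_del _ _)) //].
  by case: (s) js => //= p' s' _; rewrite mem_head.
- move=> [s0 szt ts]; split=> [|p]; first by rewrite /= szt.
  rewrite in_cons => /orP[/eqP->|/ts //].
  by case: (s) s0 => //= p' s' _; rewrite mem_head.
case: (eqVneq s [::]) => [->|s0]; first by rewrite g_nil; apply: supported0.
by apply: sub_supported (gP s) => t [].
Qed.

End FaceHomotopy.

Section SimplicialSingular.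
Variables (R : realType) (F : fieldType) (V : finType) (W : weighted_complex V).
Hypothesis weight_neq0 : forall s, s \in W -> (weight W s)%:R != 0 :> F.

Local Notation polyhedron := (classical_sets.set_type (@realization R V W)).
Local Notation simplex m := (full_simplex R 'I_m.+1).
Local Notation singular m := (continuousType (simplex m) polyhedron).
Local Notation singular_bd m := (free_ext (@singular_boundary R F polyhedron m)).
Local Notation is_singular_cycle z :=
  (is_cycle (C := singular_chain_complex R F polyhedron) z).
Local Notation weighted_bd m := (free_ext (@weighted_boundary F V W m)).
Local Notation is_weighted_cycle z :=
  (is_cycle (C := weighted_chain_complex F W) z).
Local Notation realize := (@realize R F V W).

Lemma ordered_simplex_list m l : simplex_list W m l -> ordered_simplex W m.+1 l.
Proof. by move=> [_ sl lW]; split=> //; exists [set v in l] => // v; rewrite inE. Qed.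

Lemma supported_orient_ext m (c : {free F[seq V]}) : supported (ordered_simplex W m.+1) c ->
  supported (simplex_list W m) (orient_ext c).
Proof.
apply: supported_lin_ext => s [ss [t tW st]].
apply: (sub_supported _ (@supported_orient F V s)) => l /andP[sl ls].
have szl : size l = m.+1 by rewrite (perm_size ls).
split=> //; apply: (simplex_face tW).
  by apply/fintype.subsetP => v; rewrite inE (perm_mem ls) => /st.
by apply/set0Pn; case: l szl {sl ls} => // v l _; exists v; rewrite inE mem_head.
Qed.

Lemma orient_ext_id m (c : {free F[seq V]}) : supported (simplex_list W m) c -> orient_ext c = c.
Proof.
rewrite -[RHS]/(idfun c); apply: linear_eq_supported => l [sl _ _].
by rewrite /= orient_ext_gen orient_sorted.
Qed.

Definition simplicial_to_singular m : {free F[nsimplex W m]} -> {free F[singular m]} :=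
  realize m \o @to_lists F V W m.
HB.instance Definition _ m := GRing.Linear.on (@simplicial_to_singular m).

Lemma simplicial_to_singular_bd m (c : {free F[nsimplex W m.+1]}) :
  singular_bd m (simplicial_to_singular c) =
  simplicial_to_singular (weighted_bd m c).
Proof.
rewrite /simplicial_to_singular /= bd_realize ?bd_to_lists //.
by apply: (sub_supported _ (@supported_to_lists F V W m.+1 c)) => l /ordered_simplex_list.
Qed.

Section Labelled.
Variable v0 : V.

Lemma label_push_chain m (s : singular m) (c : {free F[seq ('I_m.+1 -> R^o)]}) :
  supported (fun l => size l = m.+1 /\ {in l, forall x, full_simplex R 'I_m.+1 x}) c ->
  label_chain v0 (push_chain W m (extension s) c) = lmap (label v0 \o extension s) c.
Proof.
rewrite -[LHS]/((@label_chain R F V W v0 m \o push_chain W m (extension s)) c).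
apply: linear_eq_supported => l [sl lD] /=.
have [_ lK] := pushable_extension s sl lD.
rewrite push_gen // (singular_genE F (s := singular_of lK)) // label_chain_gen.
rewrite !lmap_gen; congr gen; apply: (@eq_from_nth _ v0).
  by rewrite [LHS]size_map size_vertices [RHS]size_map sl.
move=> i; rewrite size_map size_vertices => im.
rewrite [LHS](nth_map 0) ?size_vertices // [RHS](nth_map 0) ?sl //=; congr (label v0 _).
rewrite [X in extension _ X](nth_vertices R (Ordinal im)).
pose y : simplex m := exist _ (vertex R (Ordinal im) : {ptws _ -> R})
  (mem_set (vertex_full_simplex R (Ordinal im))).
rewrite (extensionE (singular_of lK) (y := y)) //=.
by rewrite (comb_vertex l (i := Ordinal im)).
Qed.

(** The combinatorial form of [L Sd theta], with no singular simplices involved; see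
    [label_subdivide_realize]. *)
Definition relabel k : {free F[seq V]} -> {free F[seq V]} :=
  lmap (label v0) \o (sd_iter k \o lmap (vertex R)).
HB.instance Definition _ k := GRing.Linear.on (relabel k).

Lemma relabel_nil k : relabel k (gen F [::]) = gen F [::].
Proof. by rewrite /relabel /= lmap_gen sd_iter_nil lmap_gen. Qed.

Lemma bd_relabel k c : bd (relabel k c) = relabel k (bd c).
Proof. by rewrite /relabel /= bd_lmap bd_sd_iter bd_lmap. Qed.

(** The labelling is of Sperner type: a point of the face spanned by [s] has zero coordinates off
    [s], while the coordinate at its label is nonzero. *)
Lemma supported_relabel k s :
  supported (fun t => size t = size s /\ {subset t <= s}) (relabel k (gen F s)).
Proof.
rewrite /relabel /= lmap_gen.
apply: (supported_lmap (A := fun l => size l = size s /\ {in l, forall x : V -> R^o,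
  full_simplex R V x /\ forall v, v \notin s -> x v = 0})).
  move=> l [sl lP]; split=> [|v]; first by rewrite size_map.
  move=> /mapP[x /lP[xD xs] ->]; apply: contraT => /xs/eqP.
  by rewrite (negPf (label_neq0 v0 xD)).
apply: (sub_supported _ (@supported_sd_iter F _ _ 0 k _)) => l [sl hull_l _].
split=> [|x xl]; first by rewrite sl size_map.
split.
  apply: (hull_l _ (@full_simplex_barycenter_closed R V)) xl => _ /mapP[v _ ->].
  exact: vertex_full_simplex.
move=> v vs; have vertex0 : {in map (vertex R) s, forall x : V -> R^o, linear_coord v x = 0}.
  move=> _ /mapP[w ws ->]; rewrite /linear_coord /vertex.
  by case: eqP vs => // ->; rewrite ws.
apply/eqP; rewrite eq_le; apply/andP; split.
  apply: (hull_l _ (barycenter_closed_le (phi := linear_coord v) (x := 0))) xl.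
  by move=> w /vertex0 w0; rewrite /= w0.
apply: (hull_l _ (barycenter_closed_ge (phi := linear_coord v) (x := 0))) xl.
by move=> w /vertex0 w0; rewrite /= w0.
Qed.

Lemma label_subdivide_realize k m c : supported (ordered_simplex W m.+1) c ->
  label_chain v0 (subdivide k (realize m c)) = relabel k c.
Proof.
rewrite -[LHS]/((@label_chain R F V W v0 m \o (@subdivide R F V W k m \o realize m)) c).
apply: linear_eq_supported => s sP; have [sz _] := sP.
have [_ sK] := pushable_vertices R sP.
(* The linear map sending the [i]-th standard vertex to the vertex [s_i]; it restricts to the affine
   simplex of [s], so naturality of subdivision applies. *)
pose A := @pushforward R _ _ (fun i : 'I_m.+1 => nth v0 s i).
have map_A : map A (vertices R m) = map (vertex R) s.
  have -> : s = map (fun i : 'I_m.+1 => nth v0 s i) (enum 'I_m.+1).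
    apply: (@eq_from_nth _ v0); first by rewrite size_map size_enum_ord.
    move=> i; rewrite sz => im; rewrite (nth_map (Ordinal im)) ?size_enum_ord //.
    by rewrite nth_enum_ord.
  rewrite -[LHS]map_comp -[RHS]map_comp; apply: eq_map => i /=.
  by rewrite /A pushforward_vertex.
have ext_A (x : 'I_m.+1 -> R^o) : full_simplex R 'I_m.+1 x ->
    extension (singular_of sK) x = A x.
  move=> xD; pose y : simplex m := exist _ (x : {ptws _ -> R}) (mem_set xD).
  rewrite (extensionE (singular_of sK) (y := y)) //= -map_A comb_map ?size_vertices //.
  by rewrite comb_vertices.
have realize_s : realize m (gen F s) = gen F (singular_of sK).
  by rewrite /realize /= lmap_gen push_gen ?size_map // (singular_genE F (s := singular_of sK)).
have sdD := @supported_sd_iter_vertices R F k m.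
rewrite /= realize_s /subdivide lin_ext_gen label_push_chain; last first.
  by apply: (sub_supported _ sdD) => l [].
rewrite /relabel /=.
have -> : lmap (vertex R) (gen F s) = lmap A (gen F (vertices R m)) by rewrite !lmap_gen map_A.
rewrite sd_iter_natural lmap_comp.
apply: eq_lin_ext_in; apply: (sub_supported _ sdD) => l [_ lD _].
congr gen; apply/eq_in_map => x /lD xD /=.
by rewrite ext_A.
Qed.

Lemma simplicial_to_singular_inj m (z : {free F[nsimplex W m]}) :
  is_weighted_cycle z ->
  (exists w, singular_bd m w = simplicial_to_singular z) ->
  exists w, weighted_bd m w = z.
Proof.
move=> zC [w ew].
have [k w_small] := subdivide_small v0 w.
pose G : {linear {free F[seq V]} -> {free F[seq V]}} :=
  cone_homotopy (relabel k \- idfun) (head v0).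
pose c := to_lists z.
have c_list : supported (simplex_list W m) c by exact: supported_to_lists.
have c_ord : supported (ordered_simplex W m.+1) c.
  by apply: (sub_supported _ c_list) => l /ordered_simplex_list.
have relabel_nil0 : (relabel k \- idfun) (gen F [::]) = 0 :> {free F[seq V]}.
  by rewrite /= relabel_nil subrr.
have bd_G d : bd (G d) = relabel k d - d - G (bd d).
  apply: bd_cone_homotopy => {}d.
  by rewrite /= linearB /= bd_relabel.
(* In degree 0 the chain [bd c] is a multiple of the empty list, which [G] kills. *)
have G_cycle : G (bd c) = 0.
  case: m z zC @c {w w_small ew c_list c_ord} => [|m] z zC /=; last first.
    have z0 : weighted_bd m z = 0 by exact/eqP.
    by rewrite bd_to_lists // z0 !linear0.
  rewrite -[LHS]/((G \o bd \o @to_lists F V W 0) z).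
  pose psi : {linear {free F[nsimplex W 0]} -> {free F[seq V]}} := \0.
  rewrite -[RHS]/(psi z); apply: linear_eq_gen => s.
  rewrite /= to_lists_gen [bd _]linearZ /= bd_gen.
  have /andP[_ /eqP] := valP s; rewrite cardE; case: (enum _) => // v [] //= _.
  by rewrite linear0 subr0 linearZ /= [G _]cone_homotopy_nil ?scaler0.
have G_ord : supported (ordered_simplex W m.+2) (G c).
  rewrite -[c]free_ext_id linear_free_ext; apply: supported_ext c_ord.
  move=> s [sz [t tW st]].
  apply: (sub_supported _ (@supported_face_homotopy _ _ v0 _ s relabel_nil0 _)).
    by move=> l [szl ls]; split; [rewrite szl sz | exists t => // v /ls/st].
  move=> u; apply: supportedB; first exact: supported_relabel.
  by apply: supported_gen; split.
(* As [w] bounds the realization of [c], the labels of its subdivision bound [relabel k c], which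
   exceeds [c] by [bd (G c)]. Orienting brings both chains back to increasing lists and fixes
   [c]. *)
pose y := orient_ext (label_chain v0 (subdivide k w)) - orient_ext (G c).
have y_list : supported (simplex_list W m.+1) y.
  apply: supportedB; apply: supported_orient_ext => //.
  exact: supported_label_chain.
have bd_y : bd y = c.
  rewrite linearB /= !bd_orient bd_label_chain bd_subdivide ew.
  rewrite label_subdivide_realize // bd_G G_cycle subr0.
  by rewrite [orient_ext (_ - _)]linearB /= opprB addrC subrK (orient_ext_id c_list).
exists (of_lists W m.+1 y).
by rewrite -[LHS](to_listsK weight_neq0) -bd_to_lists // of_listsK // bd_y to_listsK.
Qed.

Lemma simplicial_to_singular_surj m (z : {free F[singular m]}) :
  is_singular_cycle z ->
  exists2 z' : {free F[nsimplex W m]}, is_weighted_cycle z' &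
    exists w, singular_bd m w = z - simplicial_to_singular z'.
Proof.
move=> zC.
have [k z_small] := subdivide_small v0 z.
have sdC : is_singular_cycle (subdivide k z).
  case: m z zC z_small => [//|m] z zC _.
  have z0 : singular_bd m z = 0 by exact/eqP.
  by apply/eqP; rewrite /= bd_subdivide z0 linear0.
have [w0 w0E] := subdivide_homologous k zC.
have [w1 w1E] := straight_line_homologous sdC z_small.
pose l := label_chain v0 (subdivide k z).
have l_ord : supported (ordered_simplex W m.+1) l by exact: supported_label_chain.
pose g := @orient_ext F V \- idfun.
have g_nil : g (gen F [::]) = 0 by rewrite /g /= orient_ext_gen subrr.
pose B : {linear {free F[seq V]} -> {free F[seq V]}} :=
  cone_homotopy g (head v0).
have bd_B d : bd (B d) = orient_ext d - d - B (bd d).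
  by apply: bd_cone_homotopy => {}d; rewrite /g /= linearB /= bd_orient.
have B_l : B (bd l) = 0.
  by apply: label_chain_cycle sdC; exact: cone_homotopy_nil.
have B_ord : supported (ordered_simplex W m.+2) (B l).
  rewrite -[l]free_ext_id linear_free_ext; apply: supported_ext l_ord.
  move=> s [sz [t tW st]].
  apply: (sub_supported _ (@supported_face_homotopy _ _ v0 _ s g_nil _)).
    by move=> l' [szl ls]; split; [rewrite szl sz | exists t => // v /ls/st].
  move=> u; apply: supportedB; last by apply: supported_gen; split.
  rewrite /= orient_ext_gen; apply: (sub_supported _ (@supported_orient F V u)) => l'.
  by move=> /andP[_ l's]; split; [exact: perm_size | move=> v; rewrite (perm_mem l's)].
have c_list := supported_orient_ext l_ord.
exists (of_lists W m (orient_ext l)).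
  case: m z zC z_small sdC w0 w0E w1 w1E @l l_ord B_l B_ord c_list => [//|m] z zC z_small sdC.
  move=> w0 w0E w1 w1E l l_ord _ _ c_list; apply/eqP.
  have sd0 : singular_bd m (subdivide k z) = 0 by exact/eqP.
  rewrite -[LHS](to_listsK weight_neq0) -bd_to_lists // of_listsK //.
  by rewrite bd_orient bd_label_chain sd0 !linear0.
(* The boundaries telescope, with [Sd] for [subdivide k]: [w0] gives [z - Sd z], [w1] gives
   [realize l - Sd z], and [B l] gives [orient_ext l - l] before realization. *)
exists (w0 - w1 - realize m.+1 (B l)).
have bd_Bl : singular_bd m (realize m.+1 (B l)) =
    realize m (orient_ext l) - realize m l.
  by rewrite bd_realize // bd_B B_l subr0 [LHS]linearB.
have cE : simplicial_to_singular (of_lists W m (orient_ext l)) =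
    realize m (orient_ext l).
  by rewrite /simplicial_to_singular /= of_listsK.
rewrite [LHS]linearB /= [X in X - _ = _]linearB /= w0E w1E bd_Bl cE.
by rewrite !opprB !addrA !subrK.
Qed.

End Labelled.

Lemma weighted_singular_iso n :
  lmod_isomorphic (weighted_homology F W n) (singular_homology R F polyhedron n).
Proof.
apply: (homology_iso (C := weighted_chain_complex F W)
  (D := singular_chain_complex R F polyhedron) (f := fun m => @simplicial_to_singular m)).
- exact: simplicial_to_singular_bd.
(* Labels need a default vertex; if [V] is empty there are no simplices and all chains are 0. *)
- have [[v0 _]|noV] := pselect (exists v : V, True).
    exact: (simplicial_to_singular_inj v0).
  move=> z _ _; exists 0; rewrite linear0; symmetry.
  apply: (supported_false (A := fun=> False)) => [s []|s _].
  have /andP[/simplex_neq0/set0Pn[v _] _] := valP s.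
  by apply: noV; exists v.
have [[v0 _]|noV] := pselect (exists v : V, True).
  exact: (simplicial_to_singular_surj v0).
move=> z _; exists 0; first by case: n z => [|n] z //; rewrite /is_cycle linear0.
exists 0; rewrite !linear0 addr0; symmetry.
apply: (supported_false (A := fun=> False)) => [s []|s _].
have [y _] := extension_vertex s ord0.
have /set_mem[_ /simplex_neq0/set0Pn[v _]] := valP (s y).
by apply: noV; exists v.
Qed.

End SimplicialSingular.

(** * Homeomorphisms and weights *)

Section SingularFunctor.
Variables (R : realType) (F : fieldType).

Section PushSingular.
Variables (X Y : topologicalType) (h : continuousType X Y).

Definition singular_map n :
    {free F[(continuousType (full_simplex R 'I_n.+1) X)]} ->
    {free F[(continuousType (full_simplex R 'I_n.+1) Y)]} :=
  lin_ext (fun s : continuousType (full_simplex R 'I_n.+1) X =>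
    gen F (h \o s : continuousType (full_simplex R 'I_n.+1) Y)).
HB.instance Definition _ n := GRing.Linear.on (@singular_map n).

Lemma singular_map_bd n (c : {free F[(continuousType (full_simplex R 'I_n.+2) X)]}) :
  free_ext (@singular_boundary R F Y n) (singular_map c) =
  singular_map (free_ext (@singular_boundary R F X n) c).
Proof.
rewrite -[LHS]/((free_ext (@singular_boundary R F Y n) \o @singular_map n.+1) c).
rewrite -[RHS]/((@singular_map n \o free_ext (@singular_boundary R F X n)) c).
apply: linear_eq_gen => s; rewrite /= /singular_map lin_ext_gen !free_ext_gen.
rewrite /singular_boundary linear_sum; apply: eq_bigr => j _.
rewrite linearZ /= lin_ext_gen; congr (_ *: gen F _).
exact/continuousEP.
Qed.

End PushSingular.

Lemma singular_mapK (X Y : topologicalType) (h : continuousType X Y)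
    (g : continuousType Y X) n
    (c : {free F[(continuousType (full_simplex R 'I_n.+1) X)]}) :
  cancel h g -> singular_map g (singular_map h c) = c.
Proof.
move=> hK; rewrite -[LHS]/((@singular_map _ _ g n \o @singular_map _ _ h n) c).
rewrite -[RHS]/(idfun c); apply: linear_eq_gen => s.
rewrite /= /singular_map !lin_ext_gen; congr gen.
by apply/continuousEP => y /=; rewrite hK.
Qed.

Lemma singular_homology_homeo (X Y : topologicalType) (h : continuousType X Y)
    (g : continuousType Y X) n : cancel h g -> cancel g h ->
  lmod_isomorphic (singular_homology R F X n) (singular_homology R F Y n).
Proof.
move=> hK gK.
apply: (homology_iso (C := singular_chain_complex R F X)
  (D := singular_chain_complex R F Y) (f := fun n => @singular_map _ _ h n)).
- by move=> m c; apply: singular_map_bd.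
- move=> z _ [w ew]; exists (singular_map g w).
  by rewrite [LHS]singular_map_bd [free_ext _ _]ew /= singular_mapK.
move=> z zC; exists (singular_map g z).
  exact: (chain_map_cycle (C := singular_chain_complex R F Y)
    (D := singular_chain_complex R F X) (f := fun n => @singular_map _ _ g n)
    (fun m c => singular_map_bd g c)).
by exists 0; rewrite linear0 /= singular_mapK // subrr.
Qed.

End SingularFunctor.

Section Weights.
Variable F : fieldType.

Lemma natr_neq0_dvd (d n : nat) : (d %| n)%N -> n%:R != 0 :> F -> d%:R != 0 :> F.
Proof.
by move=> /dvdnP[q ->]; rewrite natrM mulf_eq0 negb_or => /andP[].
Qed.

Lemma inversion_weight_neq0 (V : finType) (W : weighted_complex V) :
  (forall s, s \in W -> (weight W s)%:R != 0 :> F) ->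
  forall s, s \in inversion W -> (weight (inversion W) s)%:R != 0 :> F.
Proof.
move=> W0 s sW; have vertex0 v : v \in s -> (vertex_weight W v)%:R != 0 :> F.
  move=> vs; apply: W0; apply: (simplex_face sW); first by rewrite sub1set.
  by apply/set0Pn; exists v; rewrite inE.
rewrite /= /inversion_weight; case: (wtype W).
  have /set0Pn[v vs] := simplex_neq0 sW.
  by apply: natr_neq0_dvd (vertex0 v vs); apply: (biggcdn_inf v).
apply: (big_ind (fun n => n%:R != 0 :> F)) => [|a b a0 b0|v /vertex0 //].
  exact: oner_neq0.
have : (a * b)%:R != 0 :> F by rewrite natrM mulf_neq0.
by apply: natr_neq0_dvd; rewrite -muln_lcm_gcd dvdn_mulr.
Qed.

Lemma weight_neq0_of_pchar (R : realType) (X : topologicalType) (lambda : X -> nat)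
    (V : finType) (W : weighted_complex V) :
  ([pchar F] =i pred0 \/
    exists2 p : nat, p \in [pchar F] & forall x : X, coprime p (lambda x)) ->
  weighted_triangulation R W lambda ->
  forall s, s \in W -> (weight W s)%:R != 0 :> F.
Proof.
move=> charF [h [[_ [g [_ _ gK]]] hW]] s sW; have wt0 := weight_gt0 sW.
case: charF => [/pcharf0P charF|[p pF p_coprime]].
  by rewrite charF -lt0n.
have s_gt0 : (0 < #|s|)%N by rewrite card_gt0 (simplex_neq0 sW).
(* The barycenter of [s]: its carrier is [s], so the weight of [s] is a value of [lambda] and the
   coprimality hypothesis applies to it. *)
pose b : {ptws V -> R} := fun v => (v \in s)%:R / #|s|%:R.
have card_neq0 : #|s|%:R != 0 :> R by rewrite pnatr_eq0 -lt0n.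
have carrier_b : carrier b = s.
  apply/setP => v; rewrite inE /b mulf_eq0 invr_eq0 (negPf card_neq0) orbF.
  by case: (v \in s); rewrite ?oner_eq0 ?eqxx.
have bW : realization W b.
  split; last by rewrite carrier_b.
  split=> [v|]; first by rewrite divr_ge0 ?ler0n.
  rewrite -mulr_suml -natr_sum (eq_bigr (fun v => if v \in s then 1%N else 0%N)).
    by rewrite -big_mkcond sum1_card mulfV.
  by move=> v _; case: (v \in s).
pose y : classical_sets.set_type (@realization R V W) := exist _ b (mem_set bW).
have := hW (g y); rewrite gK /= carrier_b => lambda_s.
rewrite -(dvdn_pcharf pF) -prime_coprime -?lambda_s //.
exact: pcharf_prime pF.
Qed.

End Weights.

Theorem theorem7p1 (R : realType) (X : topologicalType) (lambda : X -> nat)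
    (polyX : weighted_polyhedron R lambda) (F : fieldType)
    (charF : [pchar F] =i pred0 \/
             exists2 p : nat, p \in [pchar F]
                            & forall x : X, coprime p (lambda x))
    (V : finType) (W : weighted_complex V) (divW : divisible W)
    (triW : weighted_triangulation R W lambda) (n : nat) :
  lmod_isomorphic (AW_homology F W n) (singular_homology R F X n) /\
  lmod_isomorphic (DW_homology F W n) (singular_homology R F X n).
Proof.
have W0 := weight_neq0_of_pchar charF triW.
have [h [[h_cont [g [g_cont hK gK]]] _]] := triW.
pose hc : continuousType X _ := HB.pack h (isContinuous.Build _ _ h h_cont).
pose gc : continuousType _ X := HB.pack g (isContinuous.Build _ _ g g_cont).
have isoX := @singular_homology_homeo R F _ _ gc hc n gK hK.
have isoW : lmod_isomorphic (weighted_homology F W n) (singular_homology R F X n).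
  exact: lmod_isomorphic_trans (weighted_singular_iso R W0 n) isoX.
(* The inversion changes only the weight, so its realization is that of [W] and [isoX] serves
   again. *)
have isoI : lmod_isomorphic (weighted_homology F (inversion W) n)
    (singular_homology R F X n).
  exact: lmod_isomorphic_trans
    (weighted_singular_iso R (inversion_weight_neq0 W0) n) isoX.
by rewrite /AW_homology /DW_homology; case: (wtype W).
Qed.
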